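(* (1) Let $(E,C)$ be the separated graph associated to the presentation $\langle a,b,c\mid a+b=a+c\rangle$, i.e. with vertices $v,w_1,w_2,w_3$, edges $\alpha_1,\beta_1:v\to w_1$, $\alpha_2:v\to w_2$, $\beta_2:v\to w_3$, and $C=C_v=\{\{\alpha_1,\alpha_2\},\{\beta_1,\beta_2\}\}$. Then the corner $vC^*(E,C)v$ is the universal unital C*-algebra generated by a partial isometry. (2) Let $(F,D)$ be the separated graph associated to the presentation $\langle a,b\mid a+b=a+b\rangle$, i.e. with vertices $v,w_1,w_2$, edges $\alpha_1,\beta_1:v\to w_1$, $\alpha_2,\beta_2:v\to w_2$, and $D=D_v=\{\{\alpha_1,\alpha_2\},\{\beta_1,\beta_2\}\}$. Then $$vC^*(F,D)v\cong C^*\big((\ast_{\mathbb Z}\mathbb Z_2)\rtimes\mathbb Z\big),$$ the full group C*-algebra, where $\mathbb Z$ acts on the free product $\ast_{\mathbb Z}\mathbb Z_2$ by shifting the factors of the free product. Moreover $vC^*(E,C)v$ is (isomorphic to) a C*-subalgebra of $vC^*(F,D)v$.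
   Context: $\mathbb Z_2=\mathbb Z/2\mathbb Z$, and $\ast_{\mathbb Z}\mathbb Z_2$ is the free product of copies of $\mathbb Z_2$ indexed by $\mathbb Z$. A separated graph $(E,C)$ is a directed graph $E=(E^0,E^1,s,r)$ with $C=\bigsqcup_{u\in E^0}C_u$, where $C_u$ is a partition of $s^{-1}(u)$ into nonempty subsets (empty family if $u$ is a sink). The full graph C*-algebra $C^*(E,C)$ is the universal C*-algebra with generators $\{u,e\mid u\in E^0,\ e\in E^1\}$ subject to: (V) $uu'=\delta_{u,u'}u$ and $u=u^*$ for $u,u'\in E^0$; (E) $s(e)e=er(e)=e$ for $e\in E^1$; (SCK1) $e^*f=\delta_{e,f}r(e)$ for $e,f\in X$, $X\in C$; (SCK2) $u=\sum_{e\in X}ee^*$ for every finite $X\in C_u$, $u\in E^0$. The symbol $v$ also denotes the corresponding projection in the C*-algebra. *)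

(* Defs.v *)
From HB Require Import structures.
From mathcomp Require Import all_boot all_order all_algebra.
From mathcomp.real_closed Require Import complex.
From mathcomp Require Import boolp classical_sets functions cardinality fsbigop.
From mathcomp Require Import reals topology normedtype.

Set Implicit Arguments.
Unset Strict Implicit.
Unset Printing Implicit Defensive.

Import Order.TTheory GRing.Theory Num.Theory.
Import numFieldNormedType.Exports.

Local Open Scope classical_set_scope.
Local Open Scope ring_scope.

(* Not necessarily unital.  A norm over [R[i]] takes its values in [R[i]],
   where [x <= y] means that [y - x] is real and nonnegative. *)
HB.mixin Record isCStarAlgebra (R : realType) A
    & CompleteNormedModule R[i] A := {
  cmul : A -> A -> A;
  cstar : A -> A;
  cmulA : associative cmul;
  cmulDl : left_distributive cmul +%R;
  cmulDr : right_distributive cmul +%R;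
  cmulZl : forall (k : R[i]) (x y : A), cmul (k *: x) y = k *: cmul x y;
  cmulZr : forall (k : R[i]) (x y : A), cmul x (k *: y) = k *: cmul x y;
  cstarD : {morph cstar : x y / x + y};
  cstarZ : forall (k : R[i]) (x : A), cstar (k *: x) = k^* *: cstar x;
  cstarM : forall x y, cstar (cmul x y) = cmul (cstar y) (cstar x);
  cstarK : involutive cstar;
  cnormM : forall x y, `|cmul x y| <= `|x| * `|y|;
  cnorm_star : forall x, `|cmul (cstar x) x| = `|x| ^+ 2
}.

#[short(type="cstarType")]
HB.structure Definition CStarAlgebra (R : realType) :=
  {A of isCStarAlgebra R A & CompleteNormedModule R[i] A}.

Declare Scope cstar_scope.
Delimit Scope cstar_scope with C.
Notation "x ** y" := (cmul x y)
  (at level 40, left associativity) : cstar_scope.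
Notation "x ^#" := (cstar x) (at level 2, format "x ^#") : cstar_scope.
Local Open Scope cstar_scope.

Section CStarNotions.
Variable R : realType.
Implicit Types A B : cstarType R.

Definition star_hom A B (f : A -> B) : Prop :=
  [/\ forall x y, f (x + y) = f x + f y,
      forall (k : R[i]) x, f (k *: x) = k *: f x,
      forall x y, f (x ** y) = f x ** f y
    & forall x, f (x^#) = (f x)^#].

Definition star_isomorphic A B : Prop :=
  exists2 f : A -> B, star_hom f & bijective f.

Definition cstar_subalgebra B (S : set B) : Prop :=
  closed S /\
  [/\ S 0,
      forall x y, S x -> S y -> S (x + y),
      forall (k : R[i]) x, S x -> S (k *: x),
      forall x y, S x -> S y -> S (x ** y)
    & forall x, S x -> S (x^#)].

Definition star_embeds A B : Prop :=
  exists f : A -> B, [/\ star_hom f, injective f & cstar_subalgebra (range f)].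

Definition is_unit A (e : A) : Prop := forall x, e ** x = x /\ x ** e = x.

Definition is_projection A (p : A) : Prop := p ** p = p /\ p^# = p.

Definition partial_isometry A (s : A) : Prop := s ** s^# ** s = s.

Definition universal_partial_isometry A (s : A) : Prop :=
  exists e : A, [/\ is_unit e, partial_isometry s &
    forall (B : cstarType R) (e' t : B), is_unit e' -> partial_isometry t ->
      exists! f : A -> B, [/\ star_hom f, f e = e' & f s = t]].

Definition unitary_rep (G : groupType) A (e : A) (u : G -> A) : Prop :=
  [/\ is_unit e,
      forall g, (u g)^# ** u g = e /\ u g ** (u g)^# = e
    & forall g h, u (g * h)%g = u g ** u h].

Definition universal_unitary_rep (G : groupType) A (u : G -> A) : Prop :=
  exists e : A, unitary_rep e u /\
    forall (B : cstarType R) (e' : B) (w : G -> B), unitary_rep e' w ->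
      exists! f : A -> B, [/\ star_hom f, f e = e' & forall g, f (u g) = w g].

End CStarNotions.

(* A full group C*-algebra C*(G) of the discrete group [G]; it is unique up to
   unique isomorphism. *)
Record group_cstar (R : realType) (G : groupType) := GroupCstar {
  group_cstar_alg :> cstarType R;
  group_cstar_rep : G -> group_cstar_alg;
  group_cstarP : universal_unitary_rep group_cstar_rep
}.

Section Corner.
Variables (R : realType) (A : cstarType R) (p : A) (hp : is_projection p).

(* For a projection [p], [x] is of the form [p a p] iff [p x p = x]. *)
Definition in_corner : pred A := fun x => p ** x ** p == x.

Let c0r (x : A) : x ** 0 = 0.
Proof. by have := cmulZr 0 x 0; rewrite !scale0r. Qed.
Let c0l (x : A) : 0 ** x = 0.
Proof. by have := cmulZl 0 0 x; rewrite !scale0r. Qed.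
Let cN1r (x y : A) : x ** (- y) = - (x ** y).
Proof. by rewrite -scaleN1r cmulZr scaleN1r. Qed.
Let cN1l (x y : A) : (- x) ** y = - (x ** y).
Proof. by rewrite -scaleN1r cmulZl scaleN1r. Qed.
Let hpp : p ** p = p. Proof. by case: hp. Qed.
Let hps : p^# = p. Proof. by case: hp. Qed.

Fact corner_submod_closed : submod_closed in_corner.
Proof.
split=> [|k x y]; rewrite !unfold_in ?c0r ?c0l//.
by move=> /eqP hx /eqP hy; rewrite cmulDr cmulDl cmulZr cmulZl hx hy.
Qed.
HB.instance Definition _ :=
  GRing.isSubmodClosed.Build R[i] A in_corner corner_submod_closed.

(* The phantom argument lets the instances below depend on [hp]. *)
Definition corner_of of is_projection p := {x : A | in_corner x}.
Local Notation pAp := (corner_of hp).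

HB.instance Definition _ := SubChoice.on pAp.
HB.instance Definition _ := [SubChoice_isSubLmodule of pAp by <:].

Definition corner_norm (x : pAp) : R[i] := `|val x|.

Fact corner_normD x y : corner_norm (x + y) <= corner_norm x + corner_norm y.
Proof. exact: ler_normD. Qed.
Fact corner_normZ k x : corner_norm (k *: x) = `|k| * corner_norm x.
Proof. exact: normrZ. Qed.
Fact corner_norm0_eq0 x : corner_norm x = 0 -> x = 0.
Proof. by move=> /normr0_eq0 h; apply: val_inj. Qed.
HB.instance Definition _ := @Lmodule_isNormed.Build R[i] pAp corner_norm
  corner_normD corner_normZ corner_norm0_eq0.


Fact corner_complete (F : set_system pAp) : ProperFilter F ->
  cauchy F -> cvg F.
Proof.
move=> FF /cauchy_ballP Fc.
have vFc : cauchy ((val : pAp -> A) @ F).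
  apply/cauchy_ballP => e e0; have [[P Q] /= [FP FQ] PQ] := Fc e e0.
  exists (val @` P, val @` Q) => /=.
    by split; [apply: filterS FP|apply: filterS FQ] => x ? /=; exists x.
  move=> [_ _] /= [[x Px <-] [y Qy <-]].
  by have := PQ (x, y) (conj Px Qy); rewrite -!ball_normE.
have /cvg_ex[a /cvgrPdist_lt va] : cvg ((val : pAp -> A) @ F).
  exact: cauchy_cvg.
have pap : p ** a ** p = a.
  apply/eqP; rewrite eq_sym -subr_eq0 -normr_eq0; apply/negPn/negP => n0.
  pose M := 1 + `|p| * `|p|.
  have M0 : 0 < M by rewrite ltr_pwDl// mulr_ge0.
  have e0 : 0 < `|a - p ** a ** p| / M.
    by rewrite divr_gt0// lt_def n0 normr_ge0.
  have [x] := @filter_ex _ _ FF _ (va _ e0).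
  rewrite ltr_pdivlMr// => ltx.
  have /eqP px := valP x.
  have : `|a - p ** a ** p| <= `|a - val x| * M.
    have -> : a - p ** a ** p = (a - val x) + p ** (val x - a) ** p.
      by rewrite cmulDr cmulDl cN1r cN1l px addrA subrK.
    rewrite (le_trans (ler_normD _ _))// /M mulrDr mulr1 lerD2l.
    rewrite (le_trans (cnormM _ _))// (le_trans (ler_wpM2r _ (cnormM _ _)))//.
    by rewrite distrC mulrA [`|p| * `|a - _|]mulrC lexx.
  by move=> /le_lt_trans /(_ ltx); rewrite ltxx.
have ha : in_corner a by rewrite /in_corner pap.
apply/cvg_ex; exists (exist _ a ha : pAp).
by apply/fcvgrPdist_lt => e e0; exact: va e e0.
Qed.
HB.instance Definition _ := Uniform_isComplete.Build pAp corner_complete.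

Fact corner_pl (x : pAp) : p ** val x = val x.
Proof. by have /eqP h := valP x; rewrite -[in LHS]h !cmulA hpp h. Qed.
Fact corner_pr (x : pAp) : val x ** p = val x.
Proof. by have /eqP h := valP x; rewrite -[in LHS]h -!cmulA hpp !cmulA h. Qed.

Fact corner_mul_subproof (x y : pAp) : in_corner (val x ** val y).
Proof. by rewrite /in_corner cmulA corner_pl -cmulA corner_pr. Qed.
Fact corner_star_subproof (x : pAp) : in_corner ((val x)^#).
Proof.
move: (val x) (valP x) => y; rewrite /in_corner => /eqP h; apply/eqP.
by rewrite -[in RHS]h !cstarM hps cmulA.
Qed.
Fact corner_unit_subproof : in_corner p.
Proof. by rewrite /in_corner !hpp. Qed.

Definition corner_mul (x y : pAp) : pAp :=
  exist _ (val x ** val y) (corner_mul_subproof x y).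
Definition corner_star (x : pAp) : pAp :=
  exist _ ((val x)^#) (corner_star_subproof x).

Fact corner_mulA : associative corner_mul.
Proof. by move=> x y z; apply: val_inj; exact: cmulA. Qed.
Fact corner_mulDl : left_distributive corner_mul +%R.
Proof. by move=> x y z; apply: val_inj; exact: cmulDl. Qed.
Fact corner_mulDr : right_distributive corner_mul +%R.
Proof. by move=> x y z; apply: val_inj; exact: cmulDr. Qed.
Fact corner_mulZl (k : R[i]) x y :
  corner_mul (k *: x) y = k *: corner_mul x y.
Proof. by apply: val_inj; exact: cmulZl. Qed.
Fact corner_mulZr (k : R[i]) x y :
  corner_mul x (k *: y) = k *: corner_mul x y.
Proof. by apply: val_inj; exact: cmulZr. Qed.
Fact corner_starD : {morph corner_star : x y / x + y}.
Proof. by move=> x y; apply: val_inj; exact: cstarD. Qed.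
Fact corner_starZ (k : R[i]) x : corner_star (k *: x) = k^* *: corner_star x.
Proof. by apply: val_inj; exact: cstarZ. Qed.
Fact corner_starM x y :
  corner_star (corner_mul x y) = corner_mul (corner_star y) (corner_star x).
Proof. by apply: val_inj; exact: cstarM. Qed.
Fact corner_starK : involutive corner_star.
Proof. by move=> x; apply: val_inj; exact: cstarK. Qed.
Fact corner_normM (x y : pAp) : `|corner_mul x y| <= `|x| * `|y|.
Proof. exact: cnormM. Qed.
Fact corner_norm_star (x : pAp) : `|corner_mul (corner_star x) x| = `|x| ^+ 2.
Proof. exact: cnorm_star. Qed.

HB.instance Definition _ := isCStarAlgebra.Build R pAp
  corner_mulA corner_mulDl corner_mulDr corner_mulZl corner_mulZr
  corner_starD corner_starZ corner_starM corner_starK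
  corner_normM corner_norm_star.

Definition corner : cstarType R := pAp.

End Corner.
Arguments corner {R A p} hp.
Arguments corner_of {R A p} hp.

Record sepgraph := SepGraph {
  vertex : choiceType;
  edge : choiceType;
  src : edge -> vertex;
  rng : edge -> vertex;
  blocks : vertex -> set (set edge);
  blocksP : forall u, partition (blocks u) id [set e | src e = u]
}.

Section GraphAlgebra.
Variables (R : realType) (E : sepgraph).

Record sepgraph_family (A : cstarType R) (p : vertex E -> A)
    (t : edge E -> A) : Prop := SepgraphFamily {
  relV_mul : forall u u', p u ** p u' = if u == u' then p u else 0;
  relV_star : forall u, (p u)^# = p u;
  relE : forall e, p (src e) ** t e = t e /\ t e ** p (rng e) = t e;
  relSCK1 : forall u X e f, blocks u X -> X e -> X f ->
    (t e)^# ** t f = if e == f then p (rng e) else 0;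
  relSCK2 : forall u X, blocks u X -> finite_set X ->
    p u = \sum_(e \in X) (t e ** (t e)^#)
}.

Definition universal_sepgraph_family (A : cstarType R) (p : vertex E -> A)
    (t : edge E -> A) : Prop :=
  sepgraph_family p t /\
  forall (B : cstarType R) (q : vertex E -> B) (s : edge E -> B),
    sepgraph_family q s ->
    exists! f : A -> B,
      [/\ star_hom f, forall u, f (p u) = q u & forall e, f (t e) = s e].

End GraphAlgebra.

(* A full graph C*-algebra C*(E, C); it is unique up to unique isomorphism. *)
Record graph_cstar (R : realType) (E : sepgraph) := GraphCstar {
  graph_cstar_alg :> cstarType R;
  graph_vertex : vertex E -> graph_cstar_alg;
  graph_edge : edge E -> graph_cstar_alg;
  graph_cstarP : universal_sepgraph_family graph_vertex graph_edge
}.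

Fact graph_vertex_proj (R : realType) (E : sepgraph) (A : graph_cstar R E)
  (v : vertex E) : is_projection (graph_vertex A v).
Proof.
case: (graph_cstarP A) => -[hm hs _ _ _] _.
by split; [rewrite hm eqxx | exact: hs].
Qed.

(* The corner [v C*(E, C) v]. *)
Definition vertex_corner (R : realType) (E : sepgraph) (A : graph_cstar R E)
  (v : vertex E) : cstarType R := corner (graph_vertex_proj A v).

Inductive edge4 := alpha1 | alpha2 | beta1 | beta2.
HB.instance Definition _ := gen_eqMixin edge4.
HB.instance Definition _ := gen_choiceMixin edge4.

Inductive vertexE := vE | wE1 | wE2 | wE3.
HB.instance Definition _ := gen_eqMixin vertexE.
HB.instance Definition _ := gen_choiceMixin vertexE.

Definition rngE (e : edge4) : vertexE :=
  match e with alpha1 | beta1 => wE1 | alpha2 => wE2 | beta2 => wE3 end.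

Definition blocks2 : set (set edge4) :=
  [set [set alpha1; alpha2]; [set beta1; beta2]].

Definition blocksE (u : vertexE) : set (set edge4) :=
  if u is vE then blocks2 else set0.

Fact blocks2P : partition blocks2 id [set: edge4].
Proof.
split.
- apply/seteqP; split=> // e _.
  by case: e; [exists [set alpha1; alpha2]|exists [set alpha1; alpha2]
    |exists [set beta1; beta2]|exists [set beta1; beta2]]; rewrite /blocks2/=;
    auto.
- move=> X Y /= [->|->] [->|->] // [e [/= [->|->] [|]]] //.
- by move=> X [->|->]; [exists alpha1; left|exists beta1; left].
Qed.

Fact partition_set0 T : partition (set0 : set (set T)) id set0.
Proof. by split; [rewrite /cover bigcup_set0|move=> ?|move=> ?]. Qed.

Fact blocksEP (u : vertexE) : partition (blocksE u) id [set _ : edge4 | vE = u].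
Proof.
case: u => /=; last 3 first.
- by rewrite (_ : [set _ | _] = set0); [exact: partition_set0|apply/seteqP; split=> ?].
- by rewrite (_ : [set _ | _] = set0); [exact: partition_set0|apply/seteqP; split=> ?].
- by rewrite (_ : [set _ | _] = set0); [exact: partition_set0|apply/seteqP; split=> ?].
by rewrite (_ : [set _ | _] = setT); [exact: blocks2P|apply/seteqP; split=> ?].
Qed.

Definition graphE : sepgraph :=
  @SepGraph vertexE edge4 (fun=> vE) rngE blocksE blocksEP.

Inductive vertexF := vF | wF1 | wF2.
HB.instance Definition _ := gen_eqMixin vertexF.
HB.instance Definition _ := gen_choiceMixin vertexF.

Definition rngF (e : edge4) : vertexF :=
  match e with alpha1 | beta1 => wF1 | alpha2 | beta2 => wF2 end.

Definition blocksF (u : vertexF) : set (set edge4) :=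
  if u is vF then blocks2 else set0.

Fact blocksFP (u : vertexF) : partition (blocksF u) id [set _ : edge4 | vF = u].
Proof.
case: u => /=; last 2 first.
- by rewrite (_ : [set _ | _] = set0); [exact: partition_set0|apply/seteqP; split=> ?].
- by rewrite (_ : [set _ | _] = set0); [exact: partition_set0|apply/seteqP; split=> ?].
by rewrite (_ : [set _ | _] = setT); [exact: blocks2P|apply/seteqP; split=> ?].
Qed.

Definition graphF : sepgraph :=
  @SepGraph vertexF edge4 (fun=> vF) rngF blocksF blocksFP.

Section FreeProductZ2.
Variable I : choiceType.
Implicit Types (i j : I) (w : seq I).

(* Normal forms in the free product of copies of Z/2 indexed by [I]: the letter
   [i] is the nontrivial element of the [i]-th factor, and consecutive letters
   lie in different factors. *)
Definition reduced w : bool := sorted [rel i j | i != j] w.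

Definition freeZ2 := {w : seq I | reduced w}.
HB.instance Definition _ := SubChoice.on freeZ2.

Definition lettermul i w : seq I :=
  if w is j :: w' then (if i == j then w' else i :: w) else [:: i].

Definition wordmul w1 w2 : seq I := foldr lettermul w2 w1.

Lemma reduced_lettermul i w : reduced w -> reduced (lettermul i w).
Proof.
case: w => //= j w; case: eqVneq => [_|nij] h /=; last by rewrite nij.
exact: path_sorted h.
Qed.

Lemma lettermulK i w : reduced w -> lettermul i (lettermul i w) = w.
Proof.
case: w => /= [|j w]; first by rewrite eqxx.
case: eqVneq => [->|nij] /=; last by rewrite eqxx.
by case: w => //= k w /andP[/negPf->].
Qed.

Lemma lettermul_path i w : reduced (i :: w) -> lettermul i w = i :: w.
Proof. by case: w => //= j w /andP[/negPf->]. Qed.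

Lemma reduced_wordmul w1 w2 : reduced w2 -> reduced (wordmul w1 w2).
Proof. by move=> h; elim: w1 => //= i w; exact: reduced_lettermul. Qed.

Lemma wordmul_letter i w1 w2 : reduced w2 ->
  wordmul (lettermul i w1) w2 = lettermul i (wordmul w1 w2).
Proof.
case: w1 => //= j w1 h; case: eqVneq => //= ->.
by rewrite lettermulK// reduced_wordmul.
Qed.

Lemma wordmulA w1 w2 w3 : reduced w3 ->
  wordmul w1 (wordmul w2 w3) = wordmul (wordmul w1 w2) w3.
Proof. by move=> h; elim: w1 => //= i w ->; rewrite wordmul_letter. Qed.

Lemma wordmul1 w : reduced w -> wordmul w [::] = w.
Proof.
elim: w => //= i w IH h; rewrite -/(wordmul _ _) IH ?lettermul_path//.
exact: path_sorted h.
Qed.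

Lemma wordmulV w : wordmul (rev w) w = [::].
Proof.
elim: w => //= i w IH.
by rewrite rev_cons /wordmul foldr_rcons /= eqxx.
Qed.

Lemma reduced_rev w : reduced w -> reduced (rev w).
Proof.
rewrite /reduced rev_sorted; congr is_true; congr sorted.
by apply/funext => i; apply/funext => j /=; rewrite eq_sym.
Qed.

Definition freeZ2_one : freeZ2 := exist _ [::] isT.
Definition freeZ2_mul (x y : freeZ2) : freeZ2 :=
  exist _ (wordmul (val x) (val y)) (reduced_wordmul (val x) (valP y)).
Definition freeZ2_inv (x : freeZ2) : freeZ2 :=
  exist _ (rev (val x)) (reduced_rev (valP x)).

Fact freeZ2_mulA : associative freeZ2_mul.
Proof. by move=> x y z; apply: val_inj; exact: wordmulA (valP z). Qed.
Fact freeZ2_mul1g : left_id freeZ2_one freeZ2_mul.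
Proof. by move=> x; apply: val_inj. Qed.
Fact freeZ2_mulg1 : right_id freeZ2_one freeZ2_mul.
Proof. by move=> x; apply: val_inj; exact: wordmul1 (valP x). Qed.
Fact freeZ2_mulVg : left_inverse freeZ2_one freeZ2_inv freeZ2_mul.
Proof. by move=> x; apply: val_inj; exact: wordmulV. Qed.
Fact freeZ2_mulgV : right_inverse freeZ2_one freeZ2_inv freeZ2_mul.
Proof.
by move=> x; apply: val_inj; rewrite /= -{1}(revK (val x)) wordmulV.
Qed.
HB.instance Definition _ := isGroup.Build freeZ2
  freeZ2_mulA freeZ2_mul1g freeZ2_mulg1 freeZ2_mulVg freeZ2_mulgV.

Definition freeZ2_gen i : freeZ2 := exist _ [:: i] isT.

Lemma freeZ2_gen_mul i (x : freeZ2) :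
  val (freeZ2_gen i * x)%g = lettermul i (val x).
Proof. by []. Qed.

Lemma freeZ2_universal (H : groupType) (h : I -> H) :
  (forall i, h i * h i = 1)%g ->
  exists! f : freeZ2 -> H,
    (forall x y, f (x * y) = f x * f y)%g /\ forall i, f (freeZ2_gen i) = h i.
Proof.
move=> hh; pose g w : H := foldr (fun i z => h i * z)%g 1%g w.
have gl i w : g (lettermul i w) = (h i * g w)%g.
  by case: w => //= j w; case: eqVneq => //= ->; rewrite mulgA hh mul1g.
exists (fun x => g (val x)); split.
  split=> [x y|i]; last by rewrite /= mulg1.
  case: x y => [w1 h1] [w2 h2] /=.
  by elim: w1 {h1} => [|i w IH] /=; rewrite ?mul1g// gl IH mulgA.
move=> f [fM fg]; apply/funext => -[w hw] /=.
have f1 : f 1%g = 1%g.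
  by apply: (mulgI (f 1%g)); rewrite -fM !mulg1.
elim: w hw => [|i w IH] hw /=.
  by rewrite -f1; congr f; apply: val_inj.
have hw' : reduced w by exact: path_sorted hw.
rewrite (IH hw') -fg -fM; congr f; apply: val_inj.
by rewrite freeZ2_gen_mul /= lettermul_path.
Qed.

End FreeProductZ2.

Section Shift.
Implicit Types (n : int) (x y : freeZ2 int).

Fact reduced_shift n (w : seq int) : reduced w -> reduced (map (+%R n) w).
Proof.
rewrite /reduced sorted_map; congr is_true; congr sorted.
by apply/funext => i; apply/funext => j /=; rewrite (inj_eq (addrI n)).
Qed.

(* Maps the [i]-th factor of the free product to the [n + i]-th one. *)
Definition shift n x : freeZ2 int := exist _ (map (+%R n) (val x)) (reduced_shift n (valP x)).

Lemma shift0 x : shift 0 x = x.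
Proof.
by apply: val_inj => /=; rewrite (eq_map (g := id)) ?map_id// => i; exact: add0r.
Qed.

Lemma shiftD m n x : shift (m + n) x = shift m (shift n x).
Proof.
by apply: val_inj => /=; rewrite -map_comp; apply: eq_map => i /=; rewrite addrA.
Qed.

Lemma shiftM n x y : (shift n (x * y) = shift n x * shift n y)%g.
Proof.
apply: val_inj => /=; case: x y => [w1 h1] [w2 h2] /=.
elim: w1 {h1} => //= i w1 IH.
rewrite -IH; case: (wordmul w1 w2) => //= j w.
by rewrite (inj_eq (addrI n)); case: ifP.
Qed.

End Shift.

(* The semidirect product of [freeZ2 int] by the additive group of [int],
   acting through [shift]. *)
Definition shift_group : Type := freeZ2 int * int.
HB.instance Definition _ := Choice.on shift_group.

Section ShiftGroup.
Implicit Types x y : shift_group.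

Definition sg_one : shift_group := (1%g, 0).
Definition sg_mul x y : shift_group := ((x.1 * shift x.2 y.1)%g, x.2 + y.2).
Definition sg_inv x : shift_group := (shift (- x.2) (x.1^-1)%g, - x.2).

Lemma shift1 n : shift n 1%g = 1%g.
Proof. by apply: val_inj. Qed.

Fact sg_mulA : associative sg_mul.
Proof.
by move=> x y z; rewrite /sg_mul /= shiftM -shiftD mulgA addrA.
Qed.
Fact sg_mul1g : left_id sg_one sg_mul.
Proof. by case=> x n; rewrite /sg_mul /= shift0 mul1g add0r. Qed.
Fact sg_mulg1 : right_id sg_one sg_mul.
Proof. by case=> x n; rewrite /sg_mul /= shift1 mulg1 addr0. Qed.
Fact sg_mulVg : left_inverse sg_one sg_inv sg_mul.
Proof. by case=> x n; rewrite /sg_mul /= -shiftM mulVg shift1 addNr. Qed.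
Fact sg_mulgV : right_inverse sg_one sg_inv sg_mul.
Proof. by case=> x n; rewrite /sg_mul /= -shiftD subrr shift0 mulgV. Qed.
HB.instance Definition _ := isGroup.Build shift_group
  sg_mulA sg_mul1g sg_mulg1 sg_mulVg sg_mulgV.

End ShiftGroup.

(* Main.v *)
Require Import Defs.
From HB Require Import structures.
From mathcomp Require Import all_boot all_order all_algebra ring lra zify.
From mathcomp.real_closed Require Import complex.
From mathcomp Require Import boolp classical_sets cardinality fsbigop.
From mathcomp Require Import reals topology normedtype sequences.

(* Let [(E, C)] be one of the two graphs.  Its edges all start at [v], and every
   other vertex [w] receives an edge [t_w], so [x |-> (t_w x t_w'^#)_(w, w')]
   embeds [C^*(E, C)] in the matrices over the corner at [v].  Hence the corner
   has a universal property for unital targets [D]: a family of elements [a_e]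
   of [D] satisfying the relations gives a family in a matrix algebra over [D],
   and a homomorphism on the corner is determined by the images of the elements
   [t_e t_f^#].  This needs a C*-norm on matrices over [D], i.e. Hilbert modules
   over [D] and therefore the positivity of [x^# x].

   For [E], the universal partial isometry is [s = alpha1 beta1^#].  For [F], the
   corner is universal for a unitary [u = alpha1 beta1^# + alpha2 beta2^#] and a
   projection [p = beta1 beta1^#], equivalently for [u] and the symmetry
   [z = 2 p - 1]; the elements [u^i z u^(-i)] with [u] represent the semidirect
   product.  Finally [s |-> u p] is isometric: composed with the homomorphism
   that maps [u] to the Halmos unitary dilation of [s] and [p] to
   [diag (s^# s, 0)], it becomes [x |-> diag (x, chi x)]. *)

Set Implicit Arguments.
Unset Strict Implicit.
Unset Printing Implicit Defensive.

Import Order.TTheory GRing.Theory Num.Theory.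
Import numFieldNormedType.Exports.

Local Open Scope classical_set_scope.
Local Open Scope ring_scope.
Local Open Scope cstar_scope.
Local Open Scope complex_scope.

(** * Noncommutative polynomial identities *)

(** The C*-axioms are the only analytic input, so the order on [D] is built without spectra: [pos]
    is a norm condition, and square roots are fixed points of a contraction. The contraction exists
    only away from the boundary, so most order arguments perturb by a small scalar and pass to the
    limit. The equality of the spectra of [y^# y] and [y y^#] away from 0 is replaced by a growth
    estimate on powers. Matrices are needed even for existence on the corner. The elements of [D]
    attached to different vertices, such as [w^# w] and [e - w w^#], need not be orthogonal, so they
    satisfy (V) only after being moved to different diagonal places. The universal property of a
    graph algebra does not mention a unit either; the sum of the vertex projections has to be shown
    to be one before an amplified map can be multiplicative. *)

Section Algebra.
Variables (R : realType) (A : cstarType R).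
Implicit Types (x y z : A) (k : R[i]).

Lemma cmul0r x : x ** 0 = 0.
Proof. by have := cmulZr 0 x 0; rewrite !scale0r. Qed.
Lemma cmul0l x : 0 ** x = 0.
Proof. by have := cmulZl 0 0 x; rewrite !scale0r. Qed.
Lemma cmulNr x y : x ** (- y) = - (x ** y).
Proof. by rewrite -scaleN1r cmulZr scaleN1r. Qed.
Lemma cmulNl x y : (- x) ** y = - (x ** y).
Proof. by rewrite -scaleN1r cmulZl scaleN1r. Qed.
Lemma cmulBr x y z : x ** (y - z) = x ** y - x ** z.
Proof. by rewrite cmulDr cmulNr. Qed.
Lemma cmulBl x y z : (x - y) ** z = x ** z - y ** z.
Proof. by rewrite cmulDl cmulNl. Qed.
Lemma cstar0 : (0 : A)^# = 0.
Proof. by have := cstarZ 0 (0 : A); rewrite scale0r conjC0 scale0r. Qed.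
Lemma cstarN x : (- x)^# = - x^#.
Proof. by rewrite -scaleN1r cstarZ rmorphN1 scaleN1r. Qed.
Lemma cstarB x y : (x - y)^# = x^# - y^#.
Proof. by rewrite cstarD cstarN. Qed.

Lemma cmul_sumr (I : Type) (r : seq I) (P : pred I) (F : I -> A) x :
  x ** (\sum_(i <- r | P i) F i) = \sum_(i <- r | P i) x ** F i.
Proof. exact: (big_morph (cmul x) (cmulDr x) (cmul0r x)). Qed.
Lemma cmul_suml (I : Type) (r : seq I) (P : pred I) (F : I -> A) x :
  (\sum_(i <- r | P i) F i) ** x = \sum_(i <- r | P i) F i ** x.
Proof. exact: (big_morph (cmul^~ x) (fun a b => cmulDl a b x) (cmul0l x)). Qed.
Lemma cstar_sum (I : Type) (r : seq I) (P : pred I) (F : I -> A) :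
  (\sum_(i <- r | P i) F i)^# = \sum_(i <- r | P i) (F i)^#.
Proof. exact: (big_morph _ (@cstarD R A) cstar0). Qed.

(* Noncommutative polynomial identities are decided by normalising both sides
   to lists of words, each letter being an atom or the adjoint of an atom. *)
Inductive nexp :=
  NAtom of nat | NZero | NOne | NAdd of nexp & nexp | NOpp of nexp
| NMul of nexp & nexp | NScale of R[i] & nexp | NStar of nexp.

Section Eval.
Variables (e : A) (he : is_unit e).

Lemma unit_l x : e ** x = x. Proof. by case: (he x). Qed.
Lemma unit_r x : x ** e = x. Proof. by case: (he x). Qed.
Lemma unit_star : e^# = e.
Proof. by rewrite -[RHS]cstarK -[e^# in RHS]unit_r cstarM cstarK unit_r. Qed.

Fixpoint neval (s : seq A) (t : nexp) : A :=
  match t with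
  | NAtom i => nth 0 s i | NZero => 0 | NOne => e
  | NAdd a b => neval s a + neval s b | NOpp a => - neval s a
  | NMul a b => neval s a ** neval s b
  | NScale k a => k *: neval s a | NStar a => (neval s a)^#
  end.

Definition word := seq (bool * nat).
Definition letter (s : seq A) (l : bool * nat) : A :=
  if l.1 then (nth 0 s l.2)^# else nth 0 s l.2.
Definition weval (s : seq A) (w : word) : A :=
  foldr (fun l x => letter s l ** x) e w.
Fixpoint peval (s : seq A) (p : seq (R[i] * word)) : A :=
  if p is m :: p' then m.1 *: weval s m.2 + peval s p' else 0.

(** Equality, concatenation and reversal are redefined here with plain conditionals, so that [lazy]
    on a short list of constants computes normal forms and leaves the coefficients folded for
    [ring]. *)
Fixpoint eqword (w1 w2 : word) : bool :=
  match w1, w2 with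
  | [::], [::] => true
  | (b1, n1) :: w1, (b2, n2) :: w2 =>
      if Bool.eqb b1 b2 then if Nat.eqb n1 n2 then eqword w1 w2 else false
      else false
  | _, _ => false
  end.
Fixpoint ninsert (k : R[i]) (w : word) (p : seq (R[i] * word)) :=
  if p is (l, w') :: p' then
    if eqword w w' then (k + l, w') :: p' else (l, w') :: ninsert k w p'
  else [:: (k, w)].
Fixpoint nadd (p q : seq (R[i] * word)) :=
  if p is (k, w) :: p' then ninsert k w (nadd p' q) else q.
Fixpoint nscale (k : R[i]) (p : seq (R[i] * word)) :=
  if p is (l, w) :: p' then (k * l, w) :: nscale k p' else [::].
Fixpoint napp (w w' : word) := if w is l :: v then l :: napp v w' else w'.
Fixpoint nmulw (k : R[i]) (w : word) (p : seq (R[i] * word)) :=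
  if p is (l, w') :: p' then ninsert (k * l) (napp w w') (nmulw k w p')
  else [::].
Fixpoint nmul (p q : seq (R[i] * word)) :=
  if p is (k, w) :: p' then nadd (nmulw k w q) (nmul p' q) else [::].
Fixpoint nrev (w : word) :=
  if w is (b, n) :: v then napp (nrev v) [:: (if b then false else true, n)]
  else [::].
Fixpoint nstar (p : seq (R[i] * word)) :=
  if p is (k, w) :: p' then (k^*%R, nrev w) :: nstar p' else [::].
Fixpoint nnormal (t : nexp) : seq (R[i] * word) :=
  match t with
  | NAtom i => [:: (1, [:: (false, i)])] | NZero => [::]
  | NOne => [:: (1, [::])]
  | NAdd a b => nadd (nnormal a) (nnormal b) | NOpp a => nscale (-1) (nnormal a)
  | NMul a b => nmul (nnormal a) (nnormal b)
  | NScale k a => nscale k (nnormal a) | NStar a => nstar (nnormal a)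
  end.
(** Vanishing in [R[i]] does not compute, so words whose coefficients cancel stay in the list, and
    each coefficient becomes an equation for [ring]. *)
Fixpoint allzero (p : seq (R[i] * word)) : Prop :=
  if p is (k, w) :: p' then k = 0 /\ allzero p' else True.

Lemma eqwordP w1 w2 : eqword w1 w2 -> w1 = w2.
Proof.
elim: w1 w2 => [|[b1 n1] w1 IH] [|[b2 n2] w2] //=.
case: (boolP (Bool.eqb b1 b2)) => // /Bool.eqb_prop ->.
by case E: (Nat.eqb n1 n2) => //; move/PeanoNat.Nat.eqb_eq: E => -> /IH ->.
Qed.
Lemma ninsertE s k w p : peval s (ninsert k w p) = k *: weval s w + peval s p.
Proof.
elim: p => //= -[l w'] p IH; case: ifP => [/eqwordP -> /=|_ /=].
  by rewrite scalerDl addrA.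
by rewrite IH addrCA.
Qed.
Lemma naddE s p q : peval s (nadd p q) = peval s p + peval s q.
Proof.
by elim: p => [|[k w] p IH] /=; rewrite ?add0r// ninsertE IH addrA.
Qed.
Lemma nscaleE s k p : peval s (nscale k p) = k *: peval s p.
Proof.
by elim: p => [|[l w] p IH] /=; rewrite ?scaler0// IH scalerDr scalerA.
Qed.
Lemma nappE s w w' : weval s (napp w w') = weval s w ** weval s w'.
Proof. by elim: w => [|l w IH] /=; rewrite ?unit_l// IH cmulA. Qed.
Lemma nmulE s p q : peval s (nmul p q) = peval s p ** peval s q.
Proof.
elim: p => [|[k w] p IH] /=; first by rewrite cmul0l.
rewrite naddE IH cmulDl; congr (_ + _).
elim: q {IH} => [|[l w'] q IHq] /=; first by rewrite cmul0r.
by rewrite ninsertE IHq nappE cmulDr !cmulZl cmulZr scalerA.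
Qed.
Lemma nrevE s w : weval s (nrev w) = (weval s w)^#.
Proof.
elim: w => [|[b n] w IH] /=; first by rewrite unit_star.
rewrite nappE IH cstarM /= unit_r; congr (_ ** _).
by rewrite /letter /=; case: b; rewrite ?cstarK.
Qed.
Lemma nstarE s p : peval s (nstar p) = (peval s p)^#.
Proof.
elim: p => [|[k w] p IH] /=; first by rewrite cstar0.
by rewrite IH cstarD cstarZ nrevE.
Qed.
Lemma nnormalE s t : peval s (nnormal t) = neval s t.
Proof.
elim: t => [n|||a IHa b IHb|a IHa|a IHa b IHb|k a IHa|a IHa] //=.
- by rewrite scale1r addr0 unit_r.
- by rewrite scale1r addr0.
- by rewrite naddE IHa IHb.
- by rewrite nscaleE scaleN1r IHa.
- by rewrite nmulE IHa IHb.
- by rewrite nscaleE IHa.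
- by rewrite nstarE IHa.
Qed.
Lemma allzeroP s p : allzero p -> peval s p = 0.
Proof.
by elim: p => //= -[k w] p IH /= [-> /IH ->]; rewrite scale0r addr0.
Qed.
Lemma ncring s t u : allzero (nnormal (NAdd t (NOpp u))) -> neval s t = neval s u.
Proof.
move=> /(allzeroP s); rewrite nnormalE /= => /eqP.
by rewrite subr_eq0 => /eqP.
Qed.

End Eval.
End Algebra.

Ltac nc_mem x l :=
  lazymatch l with
  | nil => constr:(false)
  | x :: _ => constr:(true)
  | _ :: ?l' => nc_mem x l'
  end.
Ltac nc_add x l := let b := nc_mem x l in
  lazymatch b with true => l | false => constr:(cons x l) end.
Ltac nc_idx x l :=
  lazymatch l with
  | x :: _ => constr:(O)
  | _ :: ?l' => let n := nc_idx x l' in constr:(S n)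
  end.
Ltac nc_atoms e t l :=
  lazymatch t with
  | e => l
  | GRing.zero => l
  | GRing.add ?a ?b => let l1 := nc_atoms e a l in nc_atoms e b l1
  | GRing.opp ?a => nc_atoms e a l
  | cmul ?a ?b => let l1 := nc_atoms e a l in nc_atoms e b l1
  | GRing.scale _ ?a => nc_atoms e a l
  | cstar ?a => nc_atoms e a l
  | _ => nc_add t l
  end.
Ltac nc_reify R e l t :=
  lazymatch t with
  | e => constr:(@NOne R)
  | GRing.zero => constr:(@NZero R)
  | GRing.add ?a ?b =>
    let a' := nc_reify R e l a in let b' := nc_reify R e l b in
    constr:(NAdd a' b')
  | GRing.opp ?a => let a' := nc_reify R e l a in constr:(NOpp a')
  | cmul ?a ?b =>
    let a' := nc_reify R e l a in let b' := nc_reify R e l b in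
    constr:(NMul a' b')
  | GRing.scale ?k ?a => let a' := nc_reify R e l a in constr:(NScale k a')
  | cstar ?a => let a' := nc_reify R e l a in constr:(NStar a')
  | _ => let n := nc_idx t l in constr:(@NAtom R n)
  end.
Ltac nc_core he :=
  let T := type of he in
  lazymatch T with
  | @is_unit ?R ?A ?e =>
    lazymatch goal with
    | |- @eq _ ?x ?y =>
      let l0 := constr:(@nil (CStarAlgebra.sort A)) in
      let l1 := nc_atoms e x l0 in
      let l := nc_atoms e y l1 in
      let x' := nc_reify R e l x in
      let y' := nc_reify R e l y in
      apply: (@ncring R A e he l x' y');
      lazy [nnormal nadd nmul nmulw nscale nstar nrev napp ninsert eqword
            allzero Nat.eqb Bool.eqb]
    end
  end.
Ltac nc he := nc_core he; repeat split; rewrite ?rmorph1 ?rmorphN1; ring.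

(** * Norms with values in the real field *)

Section RealNorm.
Variables (R : realType) (A : cstarType R).
Implicit Types (x y z : A) (k : R[i]) (r s t : R).

(** The given norm lives in the partially ordered [R[i]]. By [rnormE] its real part loses nothing,
    and it brings estimates within reach of [lra] and [nra]. *)
Definition rnorm x : R := complex.Re `|x|.

Lemma rnormE x : `|x| = (rnorm x)%:C.
Proof. by rewrite RRe_real// normr_real. Qed.
Lemma rnorm_ge0 x : 0 <= rnorm x.
Proof. by rewrite -lecR -rnormE normr_ge0. Qed.
Lemma rnorm0 : rnorm 0 = 0. Proof. by rewrite /rnorm normr0. Qed.
Lemma rnorm_eq0 x : rnorm x = 0 -> x = 0.
Proof. by move=> h; apply: normr0_eq0; rewrite rnormE h. Qed.
Lemma rnormD x y : rnorm (x + y) <= rnorm x + rnorm y.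
Proof. by rewrite -lecR rmorphD/= -!rnormE ler_normD. Qed.
Lemma rnormN x : rnorm (- x) = rnorm x.
Proof. by rewrite /rnorm normrN. Qed.
Lemma rnormB x y : rnorm (x - y) <= rnorm x + rnorm y.
Proof. by rewrite -(rnormN y) rnormD. Qed.
Lemma rnormBC x y : rnorm (x - y) = rnorm (y - x).
Proof. by rewrite -rnormN opprB. Qed.
Lemma rnormZ r x : rnorm (r%:C *: x) = `|r| * rnorm x.
Proof.
by apply: complexI; rewrite -rnormE normrZ rnormE rmorphM/= normc_def/= expr0n addr0 sqrtr_sqr.
Qed.
Lemma rnormM x y : rnorm (x ** y) <= rnorm x * rnorm y.
Proof. by rewrite -lecR rmorphM/= -!rnormE cnormM. Qed.
Lemma rnorm_star_mul x : rnorm (x^# ** x) = rnorm x ^+ 2.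
Proof. by apply: complexI; rewrite -rnormE cnorm_star rnormE rmorphXn. Qed.
Lemma rnorm_star x : rnorm x^# = rnorm x.
Proof.
suff h y : rnorm y <= rnorm y^#.
  by apply/eqP; rewrite eq_le h andbT -{2}(cstarK x) h.
have [y0|y0] := eqVneq (rnorm y) 0; first by rewrite y0 rnorm_ge0.
have yp : 0 < rnorm y by rewrite lt_def y0 rnorm_ge0.
by rewrite -(ler_pM2r yp) -expr2 -rnorm_star_mul rnormM.
Qed.
Lemma rnorm_sq x : x^# = x -> rnorm (x ** x) = rnorm x ^+ 2.
Proof. by move=> h; rewrite -rnorm_star_mul h. Qed.

Lemma rnorm_sum (I : Type) (r : seq I) (P : pred I) (F : I -> A) :
  rnorm (\sum_(i <- r | P i) F i) <= \sum_(i <- r | P i) rnorm (F i).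
Proof.
elim/big_ind2: _ => [|u1 u2 v1 v2 h1 h2|//]; first by rewrite rnorm0.
by rewrite (le_trans (rnormD _ _))// lerD.
Qed.

Lemma rnorm_small x : (forall r, 0 < r -> rnorm x <= r) -> x = 0.
Proof.
move=> h; apply: rnorm_eq0; apply/eqP; rewrite eq_le rnorm_ge0 andbT.
by apply/ler_addgt0Pr => r /h; rewrite add0r.
Qed.

Lemma cauchy_limit (u : nat -> A) :
  (forall r, 0 < r -> exists N, forall m n, (N <= m)%N -> (N <= n)%N ->
     rnorm (u m - u n) <= r) ->
  exists l, forall r, 0 < r -> exists N, forall n, (N <= n)%N ->
    rnorm (u n - l) <= r.
Proof.
move=> h.
have : cauchy (u @ \oo).
  apply/cauchy_ballP => d d0.
  have dR : d = (complex.Re d)%:C by rewrite RRe_real// gtr0_real.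
  have r0 : 0 < complex.Re d by rewrite -ltcR -dR.
  have [N hN] := h (complex.Re d / 2) (divr_gt0 r0 (ltr0Sn _ 1)).
  exists (u @` [set n | (N <= n)%N], u @` [set n | (N <= n)%N]) => /=.
    split; exists N => //= n Nn; exists n => //.
  move=> [_ _] /= [[m Nm <-] [n Nn <-]].
  rewrite -ball_normE /= rnormE dR ltcR (le_lt_trans (hN _ _ Nm Nn))//.
  by rewrite ltr_pdivrMr// ltr_pMr// ltr1n.
move=> /cauchy_cvg/cvg_ex[l /cvgrPdist_le hl]; exists l => r r0.
have /hl [N _ hN] : 0 < r%:C by rewrite ltcR.
by exists N => n /hN; rewrite rnormE lecR rnormBC.
Qed.

End RealNorm.

(** * Square roots and positivity *)

Section SquareRoot.
Variables (R : realType) (A : cstarType R) (e : A) (he : is_unit e).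
Implicit Types (x y z : A) (r s t : R).


(** Not an equality: in the zero algebra the unit has norm 0. *)
Lemma rnorm_unit : rnorm e <= 1.
Proof.
have := rnorm_star_mul e; rewrite unit_star// unit_l// => h.
have [->//|n0] := eqVneq (rnorm e) 0.
by rewrite -(mulfI n0 (etrans (mulr1 _) (etrans h (expr2 _)))).
Qed.

Lemma rnorm_scal t : rnorm (t%:C *: e) <= `|t|.
Proof. by rewrite rnormZ ler_piMr// rnorm_unit. Qed.

Lemma scal_star t : (t%:C *: e)^# = t%:C *: e.
Proof. by rewrite cstarZ unit_star// conj_Creal// complex_real. Qed.

Lemma scaleR_star t x : (t%:C *: x)^# = t%:C *: x^#.
Proof. by rewrite cstarZ conj_Creal// complex_real. Qed.

Lemma half_add x : x = (2^-1)%:C *: x + (2^-1)%:C *: x.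
Proof.
by rewrite -scalerDl -rmorphD /= (_ : 2^-1 + 2^-1 = 1) ?scale1r//; lra.
Qed.

Lemma exists_pow_le (r s : R) : 0 <= r < 1 -> 0 < s -> exists n, r ^+ n <= s.
Proof.
move=> /andP[r0 r1] s0; have : `|r| < 1 by rewrite ger0_norm.
move=> /cvg_expr/cvgrPdist_le/(_ _ s0)[N _ /(_ N (leqnn N))].
by rewrite sub0r normrN ger0_norm ?exprn_ge0//; exists N.
Qed.

(* The solution [c] of [2 c - c ** c = x] is a fixed point of the contraction
   [c |-> (x + c ** c) / 2]; then [(e - c) ** (e - c) = e - x]. *)
Lemma sqrt_one_sub x : x^# = x -> rnorm x < 1 ->
  exists c, [/\ c^# = c, rnorm c <= 1, c + c - c ** c = x
    & forall y, x ** y = y ** x -> c ** y = y ** c].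
Proof.
move=> xs x1; pose r := rnorm x; have r0 : 0 <= r by exact: rnorm_ge0.
pose F c : A := (2^-1)%:C *: (x + c ** c).
pose u n := iter n F 0.
have h0 : (0 : R) <= 2^-1 by rewrite invr_ge0.
have nu n : rnorm (u n) <= r.
  elim: n => [|n IH] /=; first by rewrite rnorm0.
  rewrite rnormZ ger0_norm// -ler_pdivlMl ?invr_gt0// invrK.
  rewrite (le_trans (rnormD _ _))// (le_trans (lerD (lexx _) (rnormM _ _)))//.
  have : rnorm (u n) * rnorm (u n) <= r * 1.
    by apply: ler_pM; rewrite ?rnorm_ge0// (le_trans IH (ltW x1)).
  by rewrite -/(u n) -/r; lra.
have Fc a b : rnorm a <= r -> rnorm b <= r -> rnorm (F a - F b) <= r * rnorm (a - b).
  move=> ar br; rewrite -scalerBr opprD addrACA subrr add0r.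
  have -> : a ** a - b ** b = a ** (a - b) + (a - b) ** b by nc he.
  rewrite rnormZ ger0_norm// -ler_pdivlMl ?invr_gt0// invrK.
  rewrite (le_trans (rnormD _ _))//.
  have := rnormM a (a - b); have := rnormM (a - b) b.
  have := rnorm_ge0 (a - b); nra.
have us m k : rnorm (u m - u (m + k)%N) <= r ^+ m.
  elim: m k => [|m IH] k.
    by rewrite add0n sub0r rnormN expr0 (le_trans (nu _))// ltW.
  rewrite addSn /= (le_trans (Fc _ _ _ _))// ?nu// exprS.
  exact: ler_wpM2l.
have [c hc] : exists l, forall s, 0 < s -> exists N, forall n, (N <= n)%N ->
    rnorm (u n - l) <= s.
  apply: cauchy_limit => s s0.
  have [|N hN] := @exists_pow_le r (s / 2) _ (divr_gt0 s0 (ltr0Sn _ 1)).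
    by rewrite r0.
  have hd n : (N <= n)%N -> rnorm (u N - u n) <= s / 2.
    by move=> Nn; rewrite (le_trans _ hN)// -(subnKC Nn) us.
  exists N => m n Nm Nn.
  have -> : u m - u n = (u N - u n) - (u N - u m) by nc he.
  by rewrite (le_trans (rnormB _ _))//; have := hd _ Nm; have := hd _ Nn; lra.
have ncr : rnorm c <= r.
  apply/ler_addgt0Pr => s /hc[N /(_ N (leqnn N)) hN].
  have -> : c = u N - (u N - c) by nc he.
  by rewrite (le_trans (rnormB _ _))// lerD.
have us_star n : (u n)^# = u n.
  by elim: n => [|n IH] /=; rewrite ?cstar0// scaleR_star cstarD cstarM IH xs.
have us_comm y n : x ** y = y ** x -> u n ** y = y ** u n.
  move=> xy; elim: n => [|n IH] /=; first by rewrite cmul0l cmul0r.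
  rewrite cmulZl cmulZr cmulDl cmulDr xy; congr (_ *: (_ + _)).
  by rewrite -cmulA -/(u n) IH cmulA IH cmulA.
exists c; split.
- apply/eqP; rewrite -subr_eq0; apply/eqP/rnorm_small => s s0.
  have [N /(_ N (leqnn N)) hN] := hc (s / 2) (divr_gt0 s0 (ltr0Sn _ 1)).
  have -> : c^# - c = (u N - c) - (u N - c)^#.
    by rewrite cstarB us_star; nc he.
  by rewrite (le_trans (rnormB _ _))// rnorm_star; lra.
- by rewrite (le_trans ncr)// ltW.
- apply/eqP; rewrite -subr_eq0; apply/eqP/rnorm_small => s s0.
  have [N hN] := hc (s / 4) (divr_gt0 s0 (ltr0Sn _ 3)).
  have -> : c + c - c ** c - x = (c - F c) + (c - F c).
    rewrite /F; set h := (2^-1)%:C.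
    rewrite [X in _ - X](half_add x) [in LHS](half_add (c ** c)) !scalerDr; nc he.
  have -> : c - F c = (F (u N) - F c) - (u N.+1 - c) by rewrite /=; nc he.
  have := Fc (u N) c (nu N) ncr.
  have := hN N (leqnn N); have := hN N.+1 (leqnSn N).
  move=> h1 h2 h3; rewrite (le_trans (rnormD _ _))//.
  have := rnormB (F (u N) - F c) (u N.+1 - c); have := rnorm_ge0 (u N - c).
  by rewrite -/r in x1; nra.
- move=> y xy.
  apply/eqP; rewrite -subr_eq0; apply/eqP/rnorm_small => s s0.
  have d0 : 0 < s / (2 * (rnorm y + 1)).
    by rewrite divr_gt0// mulr_gt0// ltr_wpDl// rnorm_ge0.
  have [N /(_ N (leqnn N)) hN] := hc _ d0.
  have -> : c ** y - y ** c = y ** (u N - c) - (u N - c) ** y.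
    have := us_comm y N xy; rewrite !(cmulBl,cmulBr) => ->; nc he.
  rewrite (le_trans (rnormB _ _))//.
  have := rnormM y (u N - c); have := rnormM (u N - c) y.
  have y0 := rnorm_ge0 y.
  have : rnorm (u N - c) * (2 * (rnorm y + 1)) <= s.
    by rewrite -ler_pdivlMr// mulr_gt0// ltr_wpDl.
  have := rnorm_ge0 (u N - c); nra.
Qed.

(** The element [u = c + i d] satisfies [u^# u = c^2 + d^2], and its real part [c] has norm at most
    [|u|]. This gives a first order inequality before any positivity is known. *)
Lemma rnorm_sq_le_add (c d : A) : c^# = c -> d^# = d -> c ** d = d ** c ->
  rnorm (c ** c) <= rnorm (c ** c + d ** d).
Proof.
move=> cs ds cd; pose u := c + 'i *: d.
have us : u^# = c - 'i *: d by rewrite cstarD cstarZ cs ds conjCi scaleNr.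
have uu : u^# ** u = c ** c + d ** d.
  rewrite us /u !(cmulDr,cmulBl,cmulZr,cmulZl) cd scalerA -expr2 sqrCi scaleN1r.
  nc he.
have -> : rnorm (c ** c + d ** d) = rnorm u ^+ 2 by rewrite -uu rnorm_star_mul.
rewrite rnorm_sq// ler_sqr ?nnegrE ?rnorm_ge0//.
have : rnorm (c + c) <= rnorm u + rnorm u.
  have -> : c + c = u + u^# by rewrite us /u; nc he.
  by rewrite (le_trans (rnormD _ _))// rnorm_star.
have -> : c + c = (2 : R)%:C *: c by rewrite -[2](natrD _ 1 1) rmorphD scalerDl !scale1r.
by rewrite rnormZ ger0_norm//; lra.
Qed.

End SquareRoot.

Section Positivity.
Variables (R : realType) (A : cstarType R) (e : A) (he : is_unit e).
Implicit Types (x y z a b h : A) (r s t : R).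

(* The spectrum of [h] lies in a disk centred at [t] with radius [t]. *)
Definition pos h := h^# = h /\ exists2 t, 0 <= t & rnorm (t%:C *: e - h) <= t.

Lemma scal_comm t x : (t%:C *: e) ** x = x ** (t%:C *: e).
Proof. nc he. Qed.

(** Write [h = t (e - x)] with [|x| < 1]; then [sqrt t (e - c)] is a root for the [c] of
    [sqrt_one_sub]. The commutation clause does the work of functional calculus in what follows. *)
Lemma sqrt_near h t : h^# = h -> 0 < t -> rnorm (t%:C *: e - h) < t ->
  exists k, [/\ pos k, k ** k = h & forall y, h ** y = y ** h -> k ** y = y ** k].
Proof.
move=> hs t0 ht; pose x := (t^-1)%:C *: (t%:C *: e - h).
have xs : x^# = x by rewrite scaleR_star cstarB scal_star// hs.
have x1 : rnorm x < 1.
  by rewrite rnormZ ger0_norm ?invr_ge0 ?ltW// -ltr_pdivlMl ?invr_gt0// invrK mulr1.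
have [c [cs c1 cx cc]] := sqrt_one_sub he xs x1.
pose q := Num.sqrt t; have q0 : 0 <= q by exact: sqrtr_ge0.
have qq : q * q = t by rewrite -expr2 sqr_sqrtr// ltW.
exists (q%:C *: (e - c)); split.
- split; first by rewrite scaleR_star cstarB unit_star// cs.
  exists q => //; rewrite (_ : _ - _ = q%:C *: c); last by nc he.
  by rewrite rnormZ ger0_norm// ler_piMr.
- have -> : q%:C *: (e - c) ** (q%:C *: (e - c)) =
    (q * q)%:C *: (e - (c + c - c ** c)) by nc he.
  have ti : t%:C * (t^-1)%:C = 1 by rewrite -rmorphM mulfV ?gt_eqF.
  rewrite cx qq /x; do 2 rewrite ?scalerBr ?scalerA ?ti ?mul1r ?scale1r.
  nc he.
move=> y hy; have xy : x ** y = y ** x.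
  by rewrite cmulZl cmulZr cmulBl cmulBr hy scal_comm.
by rewrite cmulZl cmulZr cmulBl cmulBr (cc _ xy) (unit_l he) (unit_r he).
Qed.

Lemma pos_star h : pos h -> h^# = h. Proof. by case. Qed.

Lemma posD a b : pos a -> pos b -> pos (a + b).
Proof.
move=> [sa [t t0 ta]] [sb [s s0 tb]]; split; first by rewrite cstarD sa sb.
exists (t + s); first exact: addr_ge0.
have -> : (t + s)%:C *: e - (a + b) = (t%:C *: e - a) + (s%:C *: e - b) by nc he.
by rewrite (le_trans (rnormD _ _))// lerD.
Qed.

Lemma pos0 : pos 0.
Proof.
by split; rewrite ?cstar0//; exists 0; rewrite // scale0r subr0 rnorm0.
Qed.

Lemma posZ r a : 0 <= r -> pos a -> pos (r%:C *: a).
Proof.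
move=> r0 [sa [t t0 ta]]; split; first by rewrite scaleR_star sa.
exists (r * t); first exact: mulr_ge0.
have -> : (r * t)%:C *: e - r%:C *: a = r%:C *: (t%:C *: e - a) by nc he.
by rewrite rnormZ ger0_norm// ler_wpM2l.
Qed.

(** [pos h] allows distance exactly [t] from [t e], where the contraction argument fails. From
    [(t + r) e] the perturbed element is still at distance at most [t], now strictly below the
    radius. *)
Lemma pos_sqrt_add h r : pos h -> 0 < r ->
  exists k, [/\ pos k, k ** k = h + r%:C *: e
    & forall y, h ** y = y ** h -> k ** y = y ** k].
Proof.
move=> [hs [t t0 ht]] r0.
have [| | |k [pk kk kc]] := @sqrt_near (h + r%:C *: e) (t + r).
- by rewrite cstarD scal_star// hs.
- exact: ltr_wpDl.
- rewrite (_ : _ - _ = t%:C *: e - h); last by nc he.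
  by rewrite (le_lt_trans ht)// ltrDl.
exists k; split=> // y hy; apply: kc.
by rewrite cmulDl cmulDr hy scal_comm.
Qed.

(** The roots [c] of [a + q e] and [d] of [s e - a + q e] commute, and their squares add up to
    [(s + 2 q) e]. Hence [|a + q e| <= s + 2 q] and [|a| <= s + 3 q], which explains [q = r / 3]. *)
Lemma pos_le_scal a s : 0 <= s -> pos a -> pos (s%:C *: e - a) -> rnorm a <= s.
Proof.
move=> s0 pa pb; apply/ler_addgt0Pr => r r0; pose q := r / 3.
have q0 : 0 < q by rewrite divr_gt0.
have [c [pc cc ccomm]] := pos_sqrt_add pa q0.
have [d [pd dd dcomm]] := pos_sqrt_add pb q0.
have cd : c ** d = d ** c.
  apply: ccomm; apply/esym/dcomm.
  by rewrite cmulBl cmulBr scal_comm.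
have := rnorm_sq_le_add he (pos_star pc) (pos_star pd) cd.
have -> : c ** c + d ** d = (s + q + q)%:C *: e by rewrite cc dd; nc he.
rewrite cc => h1; have := rnorm_scal he (s + q + q).
rewrite ger0_norm; last by rewrite !addr_ge0// ltW.
have -> : a = (a + q%:C *: e) - q%:C *: e by nc he.
have := rnorm_scal he q; rewrite gtr0_norm// => h2 h3.
have -> : r = 3 * q by rewrite /q; lra.
by rewrite (le_trans (rnormB _ _))//; lra.
Qed.

Lemma pos_sub_norm h s : h^# = h -> rnorm h <= s -> pos (s%:C *: e - h).
Proof.
move=> hs hn; split; first by rewrite cstarB scal_star// hs.
exists s; first exact: le_trans (rnorm_ge0 h) hn.
by rewrite (_ : _ - _ = h) //; nc he.
Qed.

Lemma pos_mono a b : pos a -> pos (b - a) -> rnorm a <= rnorm b.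
Proof.
move=> pa pba; apply: pos_le_scal => //; first exact: rnorm_ge0.
have bs : b^# = b.
  have -> : b = a + (b - a) by nc he.
  by rewrite cstarD (pos_star pa) (pos_star pba).
have -> : (rnorm b)%:C *: e - a = ((rnorm b)%:C *: e - b) + (b - a) by nc he.
by apply: posD => //; exact: pos_sub_norm.
Qed.

(** The radius hidden in [pos] can thus be chosen as any bound of [|h|], hence uniformly along a
    convergent family. *)
Lemma pos_norm_sub h s : pos h -> rnorm h <= s -> rnorm (s%:C *: e - h) <= s.
Proof.
move=> ph hn; have s0 := le_trans (rnorm_ge0 h) hn.
apply: pos_le_scal => //; first exact: pos_sub_norm (pos_star ph) hn.
by rewrite (_ : _ - _ = h)//; nc he.
Qed.

(** For [t > |a^2|], the element [t e - a^2] is a square [d^2], and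
    [|d^2| <= |d^2 + a^2| = |t e| <= t] is the disc condition. *)
Lemma pos_sq a : a^# = a -> pos (a ** a).
Proof.
move=> sa; split; first by rewrite cstarM sa.
pose t := rnorm (a ** a) + 1.
have t0 : 0 < t by rewrite ltr_wpDl// rnorm_ge0.
exists t; first exact: ltW.
have [| | |d [pd dd dc]] := @sqrt_near (t%:C *: e - a ** a) t.
- by rewrite cstarB scal_star// cstarM sa.
- by [].
- by rewrite (_ : _ - _ = a ** a); [rewrite /t ltrDl|nc he].
have da : d ** a = a ** d.
  by apply: dc; rewrite cmulBl cmulBr scal_comm cmulA.
have := rnorm_sq_le_add he (pos_star pd) sa da.
have -> : d ** d + a ** a = t%:C *: e by rewrite dd; nc he.
by rewrite dd => /le_trans -> //; rewrite (le_trans (rnorm_scal he _))// gtr0_norm.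
Qed.

Lemma pos_limit h : h^# = h ->
  (forall r, 0 < r -> exists2 k, pos k & rnorm (h - k) <= r) -> pos h.
Proof.
move=> hs hl; split => //; exists (rnorm h + 1); first by rewrite addr_ge0// rnorm_ge0.
(* The cap 1 keeps every approximant [k] below the radius [rnorm h + 1], which does not depend on
   [r]. *)
apply/ler_addgt0Pr => r r0; pose q := Num.min r 1.
have q0 : 0 < q by rewrite lt_min r0 ltr01.
have [k pk hk] := hl _ q0.
have kn : rnorm k <= rnorm h + 1.
  have -> : k = h - (h - k) by nc he.
  by rewrite (le_trans (rnormB _ _))// lerD// (le_trans hk)// ge_min lexx orbT.
have -> : (rnorm h + 1)%:C *: e - h = ((rnorm h + 1)%:C *: e - k) - (h - k) by nc he.
rewrite (le_trans (rnormB _ _))// lerD//; first exact: pos_norm_sub.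
by rewrite (le_trans hk)// ge_min lexx.
Qed.

(** With [k] the root of [h + q e], the self-adjoint [k ** n] has square [h n^2 + q n^2], and the
    last term is arbitrarily small. *)
Lemma pos_mul_sq h n : pos h -> n^# = n -> h ** n = n ** h -> pos (h ** (n ** n)).
Proof.
move=> ph ns hn.
have hns : (h ** (n ** n))^# = h ** (n ** n).
  by rewrite !cstarM ns (pos_star ph) -cmulA -hn cmulA -hn -cmulA.
apply: pos_limit => // r r0.
pose q := r / (rnorm (n ** n) + 1).
have n0 : 0 < rnorm (n ** n) + 1 by rewrite ltr_wpDl// rnorm_ge0.
have q0 : 0 < q by rewrite divr_gt0.
have [k [pk kk kc]] := pos_sqrt_add ph q0.
have kn := kc _ hn.
exists ((k ** n) ** (k ** n)).
  by apply: pos_sq; rewrite cstarM ns (pos_star pk) kn.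
have -> : k ** n ** (k ** n) = (k ** k) ** (n ** n).
  by rewrite -!cmulA; congr (k ** _); rewrite [RHS]cmulA kn -cmulA kn.
rewrite kk (_ : _ - _ = - (q%:C *: (n ** n))); last by nc he.
rewrite rnormN rnormZ gtr0_norm// /q mulrAC ler_pdivrMr// ler_pM2l//.
by rewrite lerDl.
Qed.

End Positivity.

Section StarMulPositive.
Variables (R : realType) (A : cstarType R) (e : A) (he : is_unit e).
Implicit Types (x y z a b h : A) (r s t : R).

(** If [p > 1], Bernoulli's inequality at exponent [2^k], squared once, makes the left side at
    [k + 1] grow like [4^k], while the right side grows like [2^k]. *)
Lemma doubling_growth (p s Z : R) : 0 < s ->
  (forall k, s * p ^+ (2 ^ k) <= s + Z * 2 ^+ k) -> p <= 1.
Proof.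
move=> s0 h; rewrite leNgt; apply/negP => p1; pose d := p - 1.
have d0 : 0 < d by rewrite subr_gt0.
have bern k : 1 + 2 ^+ k * d <= p ^+ (2 ^ k).
  elim: k => [|k IH]; first by rewrite expr0 expn0 expr1 mul1r /d; lra.
  rewrite expnS mulnC exprM [2 ^+ _]exprS.
  have := exprn_ge0 k (ler0n R 2); set m := 2 ^+ k in IH * => m0.
  have : 0 <= m * d by rewrite mulr_ge0// ltW.
  rewrite expr2; nra.
have [k hk] : exists k, (s + `|Z| * 2) / (s * d ^+ 2) < 2 ^+ k.
  have := archi_boundP (_ : 0 <= (s + `|Z| * 2) / (s * d ^+ 2)).
  rewrite divr_ge0 ?addr_ge0 ?mulr_ge0 ?sqr_ge0 ?normr_ge0 ?ltW// => /(_ isT).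
  set N := Num.bound _ => hN; exists N; apply: lt_trans hN _.
  by rewrite -natrX ltr_nat ltn_expl.
move: hk; rewrite ltr_pdivrMr ?mulr_gt0 ?exprn_gt0// => hk.
have := h k.+1; have := bern k; rewrite expnS mulnC exprM [2 ^+ k.+1]exprS.
have m1 : 1 <= (2 : R) ^+ k by rewrite exprn_ege1// ler1n.
have := ler_norm Z; set W := `|Z| in hk *; set m := 2 ^+ k in hk m1 *.
set P := p ^+ _ => ZW h1 h2.
have md : 0 <= m * d by rewrite mulr_ge0 ?ltW// (lt_le_trans ltr01).
have h3 : (m * d) ^+ 2 <= P ^+ 2 by rewrite ler_sqr ?nnegrE; lra.
have h4 : s * (m * d) ^+ 2 <= s + W * (2 * m).
  apply: le_trans (ler_wpM2l (ltW s0) h3) (le_trans h2 _).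
  by rewrite lerD2l ler_wpM2r// mulr_ge0//; lra.
have h5 : s * (m * d) ^+ 2 <= (s + W * 2) * m.
  by apply: le_trans h4 _; nra.
have : m * (s + W * 2) < m * (m * (s * d ^+ 2)) by rewrite ltr_pM2l//; lra.
by rewrite !expr2 in h5 *; lra.
Qed.

(* The doubled powers of [T e + y y^#] have the form [T^n e + y q y^#] with
   [T^n e + y^# y q] the same power of [T e + y^# y], and [|q| = O(n s^(n-1))]. *)
Lemma rnorm_swap y (T s : R) : 0 <= T -> T <= s -> 0 < s ->
  rnorm (T%:C *: e + y^# ** y) <= s -> rnorm (T%:C *: e + y ** y^#) <= s.
Proof.
move=> T0 Ts s0 hb; pose a := T%:C *: e + y ** y^#.
have as_ : a^# = a by rewrite /a cstarD scal_star// cstarM cstarK.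
have step k : exists x b q, [/\ x^# = x, rnorm x = rnorm a ^+ (2 ^ k),
   rnorm b <= s ^+ (2 ^ k), s * rnorm q <= 2 ^+ k * s ^+ (2 ^ k) &
   x = (T ^+ (2 ^ k))%:C *: e + y ** q ** y^# /\
   b = (T ^+ (2 ^ k))%:C *: e + y^# ** y ** q].
  elim: k => [|k [x [b [q [xs xn bn qn [xE bE]]]]]].
    exists a, (T%:C *: e + y^# ** y), e; rewrite expn0 !expr1 expr0 mul1r.
    rewrite !(unit_r he); split => //; rewrite -[leRHS]mulr1 ler_wpM2l ?rnorm_unit//.
    exact: ltW.
  exists (x ** x), (b ** b), (q ** ((T ^+ (2 ^ k))%:C *: e + b)).
  rewrite expnS mulnC !exprM.
  set n := (2 ^ k)%N in xn bn qn xE bE *.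
  have Tn0 : 0 <= T ^+ n by rewrite exprn_ge0.
  have Tsn : T ^+ n <= s ^+ n by rewrite lerXn2r// nnegrE// ltW.
  have sn0 : 0 < s ^+ n by rewrite exprn_gt0.
  split.
  - by rewrite cstarM xs.
  - by rewrite rnorm_sq// xn.
  - by rewrite (le_trans (rnormM _ _))// expr2 ler_pM ?rnorm_ge0.
  - have h1 := rnorm_scal he (T ^+ n); rewrite ger0_norm// in h1.
    have h2 := le_trans (rnormD ((T ^+ n)%:C *: e) b) (lerD h1 bn).
    apply: le_trans (ler_wpM2l (ltW s0) (rnormM _ _)) _.
    rewrite mulrA (le_trans (ler_pM _ (rnorm_ge0 _) qn h2))//.
      by rewrite mulr_ge0 ?rnorm_ge0// ltW.
    rewrite exprS expr2.
    have : 0 <= (2 : R) ^+ k by rewrite exprn_ge0.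
    set m := 2 ^+ k; move=> m0.
    have : m * (s ^+ n * T ^+ n) <= m * (s ^+ n * s ^+ n).
      by rewrite ler_wpM2l// ler_wpM2l// ltW.
    lra.
  - rewrite expr2 !bE !xE; split; nc he.
(* For [n = 2^k], [|a|^n = |x| <= s^n + |y|^2 |q|] and [s |q| <= n s^n]. After division by [s^n],
   the [n]-th power of [|a| / s] grows at most linearly in [n]. *)
suff : rnorm a / s <= 1 by rewrite ler_pdivrMr// mul1r.
apply: (@doubling_growth _ s (rnorm y ^+ 2)) => // k.
have [x [b [q [xs xn bn qn [xE bE]]]]] := step k.
have sn0 : 0 < s ^+ (2 ^ k) by rewrite exprn_gt0.
rewrite expr_div_n -xn mulrA ler_pdivrMr// xE.
have Tsn : T ^+ (2 ^ k) <= s ^+ (2 ^ k) by rewrite lerXn2r// nnegrE// ltW.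
have h1 := rnorm_scal he (T ^+ (2 ^ k)); rewrite ger0_norm ?exprn_ge0// in h1.
have h2 : rnorm (y ** q ** y^#) <= rnorm y ^+ 2 * rnorm q.
  rewrite (le_trans (rnormM _ _))// rnorm_star mulrC expr2 -mulrA ler_wpM2l ?rnorm_ge0//.
  exact: rnormM.
have h3 : rnorm ((T ^+ (2 ^ k))%:C *: e + y ** q ** y^#) <=
    s ^+ (2 ^ k) + rnorm y ^+ 2 * rnorm q.
  by rewrite (le_trans (rnormD _ _))// lerD// (le_trans h1).
apply: le_trans (ler_wpM2l (ltW s0) h3) _.
rewrite mulrDr mulrDl lerD2l mulrCA -[leRHS]mulrA ler_wpM2l// exprn_ge0//.
exact: rnorm_ge0.
Qed.

(** As [T e + y y^# = s e - (d e - y y^#)] for [s = T + d], and likewise for [y^# y], both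
    statements are disc conditions of radius [s], and [rnorm_swap] passes from one to the other. [T]
    is chosen so that [s] exceeds the norm of [d e - y^# y]. *)
Lemma pos_swap y d : 0 <= d ->
  pos e (d%:C *: e - y^# ** y) -> pos e (d%:C *: e - y ** y^#).
Proof.
move=> d0 pb; pose T := rnorm (d%:C *: e - y^# ** y) + 1; pose s := T + d.
have T0 : 0 < T by rewrite ltr_wpDl// rnorm_ge0.
have sns : (d%:C *: e - y ** y^#)^# = d%:C *: e - y ** y^#.
  by rewrite cstarB scal_star// cstarM cstarK.
split=> //; exists s; first by rewrite addr_ge0// ltW.
rewrite (_ : _ - _ = T%:C *: e + y ** y^#); last by rewrite /s; nc he.
apply: rnorm_swap; rewrite ?lerDl ?(ltW T0)//; first by rewrite ltr_wpDr.
rewrite (_ : _ + _ = s%:C *: e - (d%:C *: e - y^# ** y)); last by rewrite /s; nc he.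
by apply: pos_norm_sub => //; rewrite /s /T; have := rnorm_ge0 (d%:C *: e - y^# ** y); lra.
Qed.

(* Kelley-Vaught: for [h = x^# x] and [m = sqrt (h^2 + r e)], the element
   [n = m - h] approximates twice the negative part of [h].  The product
   [(x n)^# (x n) = h n^2] is negative up to [r |n|], hence so is
   [(x n) (x n)^#]; as their sum is positive, [h n^2] and then [n] are small. *)
Lemma pos_star_mul x : pos e (x^# ** x).
Proof.
pose h := x^# ** x; rewrite -/h.
have hs : h^# = h by rewrite /h cstarM cstarK.
(* The goal is [|n|^2 <= 7 r]. In [n^3 = r n - 2 h n^2] the first term is bounded by [d = r |n|] and
   [h n^2] by [3 d], which adds up to [7 d]. *)
apply: (pos_limit he hs) => w w0; pose r := w ^+ 2 / 7.
have r0 : 0 < r by rewrite divr_gt0// exprn_gt0.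
have [m [pm mm mc]] := pos_sqrt_add he (pos_sq he hs) r0.
have ms := pos_star pm.
have mh : m ** h = h ** m by apply: mc; rewrite cmulA.
exists m => //; pose n := m - h.
have ns : n^# = n by rewrite cstarB ms hs.
have nh : n ** h = h ** n by rewrite cmulBl cmulBr mh.
have mn : m ** n = n ** m by rewrite cmulBl cmulBr mh.
have hn : h ** n = r%:C *: e - m ** n.
  rewrite /n !cmulBr mm -mh; nc he.
have hnn : h ** (n ** n) = r%:C *: n - m ** (n ** n).
  by rewrite cmulA hn cmulBl cmulA cmulZl unit_l.
pose y := x ** n.
have yy : y^# ** y = h ** (n ** n).
  by rewrite /y cstarM ns !cmulA -(cmulA n) -/h nh.
pose d := r * rnorm n.
have d0 : 0 <= d by rewrite mulr_ge0 ?rnorm_ge0// ltW.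
have pd : pos e (d%:C *: e - y^# ** y).
  have -> : d%:C *: e - y^# ** y =
      r%:C *: ((rnorm n)%:C *: e - n) + m ** (n ** n).
    rewrite yy hnn /d; nc he.
  apply: posD => //; last exact: pos_mul_sq.
  by apply: posZ (ltW r0) _ => //; exact: pos_sub_norm.
have pd' := pos_swap d0 pd.
have psum : pos e (y^# ** y + y ** y^#).
  (* Real and imaginary parts of [y]: [y^# y + y y^# = 2 (a^2 + b^2)] needs only positivity of
     squares of self-adjoint elements. *)
  pose a := (2^-1)%:C *: (y + y^#); pose b := (2^-1)%:C *: ('i *: (y^# - y)).
  have sa : a^# = a by rewrite scaleR_star cstarD cstarK addrC.
  have sb : b^# = b.
    rewrite scaleR_star cstarZ conjCi cstarB cstarK; congr (_ *: _).
    by rewrite scaleNr -scalerN opprB.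
  have E : a ** a + b ** b = (2^-1)%:C *: (y^# ** y + y ** y^#).
    have ii (u : A) : 'i *: ('i *: u) = - u.
      by rewrite scalerA -expr2 sqrCi scaleN1r.
    pose u := y^# - y; pose v := y + y^#; pose c := (2^-1 : R)%:C.
    have -> : b ** b = - (c *: (c *: (u ** u))).
      by rewrite /b cmulZl cmulZr cmulZl cmulZr ii !scalerN.
    have -> : a ** a = c *: (c *: (v ** v)) by rewrite /a cmulZl cmulZr.
    rewrite -!scalerBr; congr (_ *: _); rewrite [RHS]half_add -scalerDr.
    congr (_ *: _); rewrite /u /v; nc he.
  have -> : y^# ** y + y ** y^# = (2 : R)%:C *: (a ** a + b ** b).
    by rewrite E scalerA -rmorphM mulfV ?pnatr_eq0// rmorph1 scale1r.
  by apply: posZ => //; apply: posD => //; exact: pos_sq.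
have pyd : pos e ((d + d)%:C *: e - (d%:C *: e - y^# ** y)).
  rewrite (_ : _ - _ = (y^# ** y + y ** y^#) + (d%:C *: e - y ** y^#)).
    exact: posD.
  nc he.
have hyy : rnorm (y^# ** y) <= 3 * d.
  have h0 := pos_le_scal he (addr_ge0 d0 d0) pd pyd.
  have -> : y^# ** y = d%:C *: e - (d%:C *: e - y^# ** y) by nc he.
  have := rnorm_scal he d; rewrite ger0_norm// => h1.
  by rewrite (le_trans (rnormB _ _))//; lra.
have n3 : rnorm (n ** (n ** n)) <= 7 * d.
  have -> : n ** (n ** n) = r%:C *: n - (h ** (n ** n) + h ** (n ** n)).
    rewrite {1}/n cmulBl {2}hnn; nc he.
  rewrite -yy (le_trans (rnormB _ _))// rnormZ gtr0_norm//.
  by have := rnormD (y^# ** y) (y^# ** y); rewrite /d in hyy *; lra.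
have n4 : rnorm n ^+ 4 <= rnorm n * (7 * d).
  rewrite (_ : rnorm n ^+ 4 = rnorm (n ** (n ** (n ** n)))).
    by rewrite (le_trans (rnormM _ _))// ler_wpM2l// rnorm_ge0.
  rewrite cmulA rnorm_sq; last by rewrite cstarM ns.
  by rewrite rnorm_sq// -exprM.
rewrite rnormBC -/n; have [->|n0] := eqVneq (rnorm n) 0; first exact: ltW.
have n_gt0 : 0 < rnorm n by rewrite lt_def n0 rnorm_ge0.
rewrite -ler_sqr ?nnegrE ?rnorm_ge0 ?(ltW w0)//.
rewrite -(ler_pM2l (exprn_gt0 2 n_gt0)) -exprD (le_trans n4)//.
by rewrite /d /r; lra.
Qed.

Lemma rnorm_star_mul_le_add x z : pos e z -> rnorm x ^+ 2 <= rnorm (x^# ** x + z).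
Proof.
move=> pz; rewrite -rnorm_star_mul; apply: (pos_mono he (pos_star_mul x)).
by rewrite (_ : _ - _ = z)//; nc he.
Qed.

End StarMulPositive.

(** * Hilbert modules and matrix algebras *)

Section HilbertModule.
Variables (R : realType) (D : cstarType R) (e : D) (he : is_unit e) (I : finType).
Implicit Types (x y z : {ffun I -> D}) (b : D) (r s t : R).

Definition inner x y : D := \sum_i (x i)^# ** y i.
Definition hnorm x : R := Num.sqrt (rnorm (inner x x)).

Lemma inner_star x y : (inner x y)^# = inner y x.
Proof. by rewrite cstar_sum; apply: eq_bigr => i _; rewrite cstarM cstarK. Qed.
Lemma innerDr x y z : inner x (y + z) = inner x y + inner x z.
Proof. by rewrite -big_split; apply: eq_bigr => i _; rewrite ffunE cmulDr. Qed.
Lemma innerDl x y z : inner (x + y) z = inner x z + inner y z.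
Proof. by rewrite -inner_star innerDr cstarD !inner_star. Qed.
Lemma innerMr x y b : inner x [ffun i => y i ** b] = inner x y ** b.
Proof. by rewrite cmul_suml; apply: eq_bigr => i _; rewrite ffunE cmulA. Qed.
Lemma innerMl x y b : inner [ffun i => x i ** b] y = b^# ** inner x y.
Proof. by rewrite -inner_star innerMr cstarM inner_star. Qed.

Lemma pos_sum (J : Type) (r : seq J) (P : pred J) (F : J -> D) :
  (forall j, P j -> pos e (F j)) -> pos e (\sum_(j <- r | P j) F j).
Proof. by move=> h; elim/big_ind: _ => //; [exact: pos0|exact: posD]. Qed.

Lemma inner_pos x : pos e (inner x x).
Proof. by apply: pos_sum => i _; exact: pos_star_mul. Qed.

Lemma hnorm_ge0 x : 0 <= hnorm x. Proof. exact: sqrtr_ge0. Qed.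
Lemma hnorm_sq x : hnorm x ^+ 2 = rnorm (inner x x).
Proof. by rewrite sqr_sqrtr// rnorm_ge0. Qed.

Lemma rnorm_le_hnorm x i : rnorm (x i) <= hnorm x.
Proof.
rewrite -ler_sqr ?nnegrE ?rnorm_ge0 ?hnorm_ge0// hnorm_sq /inner (bigD1 i)//=.
by apply: rnorm_star_mul_le_add => //; apply: pos_sum => j _; exact: pos_star_mul.
Qed.

Lemma hnorm_le_sum x : hnorm x <= \sum_i rnorm (x i).
Proof.
have s0 : 0 <= \sum_i rnorm (x i) by apply: sumr_ge0 => i _; exact: rnorm_ge0.
rewrite -ler_sqr ?nnegrE ?hnorm_ge0// hnorm_sq (le_trans (rnorm_sum _ _ _))//.
rewrite expr2 mulr_suml; apply: ler_sum => i _.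
rewrite rnorm_star_mul expr2 ler_wpM2l ?rnorm_ge0// (bigD1 i)//= lerDl.
by apply: sumr_ge0 => j _; exact: rnorm_ge0.
Qed.

(* [r^4 <x,x> = r^2 b^# b + <z,z> + (c b)^# (c b)] for [b = <y,x>],
   [z = r^2 x - y b] and [c = sqrt (r^2 e - <y,y>)]. *)
Lemma rnorm_inner_lt x y r : 0 < r -> hnorm y < r -> rnorm (inner y x) <= r * hnorm x.
Proof.
move=> r0 yr; pose b := inner y x.
have yr2 : rnorm (inner y y) < r ^+ 2 by rewrite -hnorm_sq ltr_sqr ?nnegrE ?hnorm_ge0// ltW.
have [| | |c [pc cc _]] := @sqrt_near _ _ e he ((r ^+ 2)%:C *: e - inner y y) (r ^+ 2).
- by rewrite cstarB scal_star// inner_star.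
- by rewrite exprn_gt0.
- by rewrite (_ : _ - _ = inner y y)//; nc he.
pose z : {ffun I -> D} :=
  [ffun i => x i ** ((r ^+ 2)%:C *: e)] + [ffun i => y i ** (- b)].
have key : inner x x ** ((r ^+ 4)%:C *: e) =
  (r%:C *: b)^# ** (r%:C *: b) + (inner z z + (c ** b)^# ** (c ** b)).
  rewrite /z !(innerDl,innerDr,innerMl,innerMr) !scaleR_star (unit_star he) cstarM (pos_star pc).
  rewrite (_ : b^# ** c ** (c ** b) = b^# ** (c ** c) ** b); last by nc he.
  rewrite cc -(inner_star y x) -/b cstarN; nc he.
have : rnorm (r%:C *: b) ^+ 2 <= rnorm (inner x x ** ((r ^+ 4)%:C *: e)).
  rewrite key; apply: (rnorm_star_mul_le_add he); apply: posD => //.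
  - exact: inner_pos.
  - exact: pos_star_mul.
rewrite cmulZr unit_r// !rnormZ -hnorm_sq (ger0_norm (ltW r0)) ger0_norm; last first.
  by rewrite exprn_ge0// ltW.
rewrite (_ : r ^+ 4 = (r ^+ 2) ^+ 2); last by rewrite -exprM.
rewrite -exprMn ler_sqr ?nnegrE; last 2 first.
- by rewrite mulr_ge0 ?rnorm_ge0// ltW.
- by rewrite mulr_ge0 ?hnorm_ge0// exprn_ge0// ltW.
by rewrite expr2 -mulrA ler_pM2l.
Qed.

(** [rnorm_inner_lt] asks for a strict bound on [hnorm y]; exceeding it by [d] costs [d * hnorm x],
    which is at most [s]. *)
Lemma cauchy_schwarz x y : rnorm (inner y x) <= hnorm y * hnorm x.
Proof.
apply/ler_addgt0Pr => s s0; pose d := s / (hnorm x + 1).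
have x1 : 0 < hnorm x + 1 by rewrite ltr_wpDl// hnorm_ge0.
have d0 : 0 < d by rewrite divr_gt0.
have := @rnorm_inner_lt x y (hnorm y + d); rewrite ltr_wpDl ?hnorm_ge0// ltrDl d0.
move=> /(_ isT isT) /le_trans -> //.
rewrite mulrDl lerD2l /d mulrAC ler_pdivrMr// ler_pM2l//.
by rewrite lerDl.
Qed.

Lemma hnormD x y : hnorm (x + y) <= hnorm x + hnorm y.
Proof.
rewrite -ler_sqr ?nnegrE ?addr_ge0 ?hnorm_ge0// hnorm_sq innerDl !innerDr.
have := cauchy_schwarz x y; have := cauchy_schwarz y x.
have := hnorm_sq x; have := hnorm_sq y.
have := rnormD (inner x x + inner x y) (inner y x + inner y y).
have := rnormD (inner x x) (inner x y); have := rnormD (inner y x) (inner y y).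
rewrite !expr2; lra.
Qed.

End HilbertModule.

Section OperatorNorm.
Variables (R : realType) (D : cstarType R) (e : D) (he : is_unit e) (I : finType).
Implicit Types (x y z : {ffun I -> D}) (S T : {ffun I * I -> D}) (r s t : R).

(** Matrices are finite functions on pairs: a [cstarType] is not a ring structure, and finite
    functions already form a module over [R[i]]. *)
Definition mulv T x : {ffun I -> D} := [ffun i => \sum_j T (i, j) ** x j].
Definition mulm S T : {ffun I * I -> D} :=
  [ffun p => \sum_k S (p.1, k) ** T (k, p.2)].
Definition starm T : {ffun I * I -> D} := [ffun p => (T (p.2, p.1))^#].

Lemma mulmv S T x : mulv (mulm S T) x = mulv S (mulv T x).
Proof.
apply/ffunP => i; rewrite !ffunE.
under [RHS]eq_bigr do rewrite ffunE cmul_sumr.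
rewrite exchange_big; apply: eq_bigr => j _.
by rewrite ffunE cmul_suml; apply: eq_bigr => k _; rewrite cmulA.
Qed.
Lemma mulvDl S T x : mulv (S + T) x = mulv S x + mulv T x.
Proof.
apply/ffunP => i; rewrite !ffunE -big_split; apply: eq_bigr => j _.
by rewrite ffunE cmulDl.
Qed.
Lemma mulvZ (k : R[i]) T x : mulv (k *: T) x = k *: mulv T x.
Proof.
apply/ffunP => i; rewrite !ffunE scaler_sumr; apply: eq_bigr => j _.
by rewrite ffunE cmulZl.
Qed.
Lemma inner_mulv T x y : inner x (mulv T y) = inner (mulv (starm T) x) y.
Proof.
rewrite /inner; under eq_bigr do rewrite ffunE cmul_sumr.
rewrite exchange_big; apply: eq_bigr => j _.
rewrite ffunE cstar_sum cmul_suml; apply: eq_bigr => i _.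
by rewrite ffunE cstarM cstarK cmulA.
Qed.

Definition bounds T : set R := [set M | 0 <= M /\ forall x, hnorm (mulv T x) <= M * hnorm x].
Definition opnorm T : R := inf (bounds T).

Lemma hnormZ (k : R[i]) x : hnorm (k *: x) = complex.Re `|k| * hnorm x.
Proof.
rewrite /hnorm; have -> : inner (k *: x) (k *: x) = (`|k| ^+ 2) *: inner x x.
  rewrite /inner scaler_sumr; apply: eq_bigr => i _; rewrite !ffunE.
  by rewrite cstarZ cmulZl cmulZr scalerA -normCKC.
have kR : `|k| = (complex.Re `|k|)%:C by rewrite RRe_real// normr_real.
have k0 : 0 <= complex.Re `|k| by rewrite -lecR -kR normr_ge0.
rewrite {1}kR -rmorphXn rnormZ sqrtrM; last by rewrite normr_ge0.
by rewrite ger0_norm ?sqr_ge0// sqrtr_sqr ger0_norm.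
Qed.

Lemma sum_bound T : bounds T (\sum_i \sum_j rnorm (T (i, j))).
Proof.
split; first by apply: sumr_ge0 => i _; apply: sumr_ge0 => j _; exact: rnorm_ge0.
move=> x; rewrite (le_trans (hnorm_le_sum _))// mulr_suml ler_sum// => i _.
rewrite ffunE (le_trans (rnorm_sum _ _ _))// mulr_suml ler_sum// => j _.
by rewrite (le_trans (rnormM _ _))// ler_wpM2l ?rnorm_ge0// (rnorm_le_hnorm he).
Qed.

Lemma bounds_lb T : lbound (bounds T) 0.
Proof. by move=> M []. Qed.

Lemma opnorm_ge0 T : 0 <= opnorm T.
Proof.
apply: lb_le_inf; last exact: bounds_lb.
by exists (\sum_i \sum_j rnorm (T (i, j))); exact: sum_bound.
Qed.

Lemma opnorm_le T M : 0 <= M -> (forall x, hnorm (mulv T x) <= M * hnorm x) -> opnorm T <= M.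
Proof. by move=> M0 h; apply: ge_inf => //; exists 0; exact: bounds_lb. Qed.

Lemma hnorm_mulv T x : hnorm (mulv T x) <= opnorm T * hnorm x.
Proof.
have [x0|x0] := eqVneq (hnorm x) 0.
  by have [_ /(_ x)] := sum_bound T; rewrite x0 !mulr0.
have xp : 0 < hnorm x by rewrite lt_def x0 hnorm_ge0.
rewrite -ler_pdivrMr//; apply: lb_le_inf; first by eexists; exact: sum_bound.
by move=> M [M0 hM]; rewrite ler_pdivrMr.
Qed.

Lemma opnorm_le_sum T : opnorm T <= \sum_i \sum_j rnorm (T (i, j)).
Proof. by have [h0 h] := sum_bound T; exact: opnorm_le. Qed.

(** [T] is tested on the [j]-th basis vector, of norm at most 1. Definiteness of the norm and
    completeness both reduce to entries through this bound. *)
Lemma rnorm_entry T i j : rnorm (T (i, j)) <= opnorm T.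
Proof.
pose x : {ffun I -> D} := [ffun k => if k == j then e else 0].
have Tx : mulv T x i = T (i, j).
  rewrite ffunE (bigD1 j)//= big1 => [|k /negPf kj]; rewrite ffunE ?kj ?cmul0r//.
  by rewrite eqxx unit_r// addr0.
have x1 : hnorm x <= 1.
  rewrite (le_trans (hnorm_le_sum _))// (bigD1 j)//= big1 => [|k /negPf kj].
    by rewrite ffunE eqxx addr0 rnorm_unit.
  by rewrite ffunE kj rnorm0.
rewrite -Tx (le_trans (rnorm_le_hnorm he _ _))// (le_trans (hnorm_mulv _ _))//.
by rewrite ler_piMr// opnorm_ge0.
Qed.

Lemma opnormD S T : opnorm (S + T) <= opnorm S + opnorm T.
Proof.
apply: opnorm_le => [|x]; first by rewrite addr_ge0 ?opnorm_ge0.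
by rewrite mulvDl mulrDl (le_trans (hnormD he _ _))// lerD ?hnorm_mulv.
Qed.

Lemma opnormM S T : opnorm (mulm S T) <= opnorm S * opnorm T.
Proof.
apply: opnorm_le => [|x]; first by rewrite mulr_ge0 ?opnorm_ge0.
rewrite mulmv (le_trans (hnorm_mulv _ _))// -mulrA ler_wpM2l ?opnorm_ge0//.
exact: hnorm_mulv.
Qed.

Lemma opnormZ_le (k : R[i]) T : opnorm (k *: T) <= complex.Re `|k| * opnorm T.
Proof.
have k0 : 0 <= complex.Re `|k| by rewrite -lecR RRe_real ?normr_real// normr_ge0.
apply: opnorm_le => [|x]; first by rewrite mulr_ge0 ?opnorm_ge0.
by rewrite mulvZ hnormZ -mulrA ler_wpM2l// hnorm_mulv.
Qed.

Lemma opnorm0_eq0 T : opnorm T = 0 -> T = 0.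
Proof.
move=> h; apply/ffunP => -[i j]; rewrite ffunE; apply/rnorm_eq0/eqP.
by rewrite eq_le rnorm_ge0 andbT -h rnorm_entry.
Qed.

Lemma opnormZ (k : R[i]) T : opnorm (k *: T) = complex.Re `|k| * opnorm T.
Proof.
have [->|k0] := eqVneq k 0.
  rewrite scale0r normr0 mul0r; apply/eqP; rewrite eq_le opnorm_ge0 andbT.
  rewrite (le_trans (opnorm_le_sum _))// big1// => i _; rewrite big1// => j _.
  by rewrite ffunE rnorm0.
apply/eqP; rewrite eq_le opnormZ_le /=.
have kR : `|k| = (complex.Re `|k|)%:C by rewrite RRe_real// normr_real.
have kp : 0 < complex.Re `|k| by rewrite -ltcR -kR normr_gt0.
have := opnormZ_le k^-1 (k *: T).
rewrite scalerA mulVf// scale1r normfV kR -fmorphV/=.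
by rewrite ler_pdivlMl.
Qed.

Lemma starmK : involutive starm.
Proof. by move=> T; apply/ffunP => -[i j]; rewrite !ffunE cstarK. Qed.
Lemma starmM S T : starm (mulm S T) = mulm (starm T) (starm S).
Proof.
apply/ffunP => -[i j]; rewrite !ffunE cstar_sum; apply: eq_bigr => k _.
by rewrite !ffunE cstarM.
Qed.

Lemma opnorm_sq_le T : opnorm T ^+ 2 <= opnorm (mulm (starm T) T).
Proof.
pose q := opnorm (mulm (starm T) T).
have q0 : 0 <= q by exact: opnorm_ge0.
rewrite -[leRHS](sqr_sqrtr q0) ler_sqr ?nnegrE ?opnorm_ge0 ?sqrtr_ge0//.
apply: opnorm_le => [|x]; first exact: sqrtr_ge0.
rewrite -ler_sqr ?nnegrE ?mulr_ge0 ?hnorm_ge0 ?sqrtr_ge0// exprMn (sqr_sqrtr q0).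
rewrite [leLHS]hnorm_sq inner_mulv -mulmv -inner_star rnorm_star.
rewrite (le_trans (cauchy_schwarz he _ _))//.
by rewrite mulrC expr2 mulrA ler_wpM2r ?hnorm_ge0// hnorm_mulv.
Qed.

Lemma opnorm_star T : opnorm (starm T) = opnorm T.
Proof.
suff h S : opnorm S <= opnorm (starm S).
  by apply/eqP; rewrite eq_le h andbT -{2}(starmK T) h.
have [->|S0] := eqVneq (opnorm S) 0; first exact: opnorm_ge0.
have Sp : 0 < opnorm S by rewrite lt_def S0 opnorm_ge0.
by rewrite -(ler_pM2r Sp) -expr2 (le_trans (opnorm_sq_le S))// opnormM.
Qed.

Lemma opnorm_cstar T : opnorm (mulm (starm T) T) = opnorm T ^+ 2.
Proof.
apply/eqP; rewrite eq_le opnorm_sq_le andbT (le_trans (opnormM _ _))//.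
by rewrite opnorm_star expr2.
Qed.

End OperatorNorm.

Section MatrixAlgebra.
Variables (R : realType) (D : cstarType R) (e : D) (he : is_unit e) (I : finType).

(** The type records [he] because the norm axioms in the instances below depend on it. *)
Definition cmx of is_unit e := {ffun I * I -> D}.
Local Notation M := (cmx he).

HB.instance Definition _ := GRing.Lmodule.on M.

Definition cmx_norm (T : M) : R[i] := (opnorm T)%:C.

Fact cmx_normD (S T : M) : cmx_norm (S + T) <= cmx_norm S + cmx_norm T.
Proof. by rewrite -rmorphD lecR (opnormD he). Qed.
Fact cmx_normZ k (T : M) : cmx_norm (k *: T) = `|k| * cmx_norm T.
Proof.
by rewrite /cmx_norm (opnormZ he) rmorphM; congr (_ * _).
Qed.
Fact cmx_norm0_eq0 (T : M) : cmx_norm T = 0 -> T = 0.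
Proof. by move=> /complexI /(opnorm0_eq0 he). Qed.
HB.instance Definition _ := @Lmodule_isNormed.Build R[i] M cmx_norm
  cmx_normD cmx_normZ cmx_norm0_eq0.

Fact cmx_complete (F : set_system M) : ProperFilter F -> cauchy F -> cvg F.
Proof.
move=> FF /cauchy_ballP Fc.
have ent p : exists a, forall r : R[i], 0 < r -> \forall T \near F, `|a - (T : M) p| < r.
  case: p => i j.
  have Fpc : cauchy ((fun T : M => T (i, j)) @ F).
    apply/cauchy_ballP => d d0; have [[P Q] /= [FP FQ] PQ] := Fc d d0.
    exists ((fun T : M => T (i, j)) @` P, (fun T : M => T (i, j)) @` Q) => /=.
      by split; [apply: filterS FP|apply: filterS FQ] => x ? /=; exists x.
    move=> [_ _] /= [[S PS <-] [T QT <-]].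
    have := PQ (S, T) (conj PS QT); rewrite -!ball_normE /=.
    apply: le_lt_trans; rewrite rnormE lecR.
    by have := rnorm_entry he (S - T) i j; rewrite !ffunE.
  have /cvg_ex[a /cvgrPdist_lt ha] : cvg ((fun T : M => T (i, j)) @ F).
    exact: cauchy_cvg.
  by exists a => r r0; exact: ha.
have /choice[a ha] := ent.
apply/cvg_ex; exists ([ffun p => a p] : M).
apply/fcvgrPdist_lt => d d0.
have dR : d = (complex.Re d)%:C by rewrite RRe_real// gtr0_real.
have rd0 : 0 < complex.Re d by rewrite -ltcR -dR.
(* The successor makes the sum of [q] over all entries strictly smaller than [d], also for an empty
   [I]. *)
pose q := complex.Re d / (#|{: I}| * #|{: I}|).+1%:R.
have q0 : 0 < q%:C by rewrite ltcR divr_gt0.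
have : \forall T \near F, forall p, `|a p - (T : M) p| < q%:C.
  by apply: filter_forall => p; exact: ha.
apply: filterS => T hT; rewrite dR ltcR.
rewrite (le_lt_trans (opnorm_le_sum he _))//.
have : \sum_i \sum_j rnorm (([ffun p => a p] - T : {ffun _}) (i, j)) <=
    \sum_(i : I) \sum_(j : I) q.
  apply: ler_sum => i _; apply: ler_sum => j _; rewrite !ffunE.
  by have := hT (i, j); rewrite rnormE ltcR => /ltW.
move=> /le_lt_trans -> //; rewrite !sumr_const -mulrnA -mulr_natr /q.
by rewrite mulrAC ltr_pdivrMr// ltr_pM2l// ltr_nat.
Qed.
HB.instance Definition _ := Uniform_isComplete.Build M cmx_complete.

Fact cmx_mulA : associative (@mulm R D I : M -> M -> M).
Proof.
move=> S T U; apply/ffunP => -[i j]; rewrite !ffunE /=.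
under eq_bigr do rewrite ffunE cmul_sumr.
rewrite exchange_big; apply: eq_bigr => k _ /=.
by rewrite ffunE cmul_suml; apply: eq_bigr => l _; rewrite cmulA.
Qed.
Fact cmx_mulDl : left_distributive (@mulm R D I : M -> M -> M) +%R.
Proof.
move=> S T U; apply/ffunP => p; rewrite !ffunE -big_split; apply: eq_bigr => k _.
by rewrite !ffunE cmulDl.
Qed.
Fact cmx_mulDr : right_distributive (@mulm R D I : M -> M -> M) +%R.
Proof.
move=> S T U; apply/ffunP => p; rewrite !ffunE -big_split; apply: eq_bigr => k _.
by rewrite !ffunE cmulDr.
Qed.
Fact cmx_mulZl (k : R[i]) (S T : M) : mulm (k *: S) T = k *: mulm S T.
Proof.
apply/ffunP => p; rewrite !ffunE scaler_sumr; apply: eq_bigr => l _.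
by rewrite ffunE cmulZl.
Qed.
Fact cmx_mulZr (k : R[i]) (S T : M) : mulm S (k *: T) = k *: mulm S T.
Proof.
apply/ffunP => p; rewrite !ffunE scaler_sumr; apply: eq_bigr => l _.
by rewrite ffunE cmulZr.
Qed.
Fact cmx_starD : {morph (@starm R D I : M -> M) : S T / S + T}.
Proof. by move=> S T; apply/ffunP => p; rewrite !ffunE cstarD. Qed.
Fact cmx_starZ (k : R[i]) (T : M) : starm (k *: T) = k^*%R *: starm T.
Proof. by apply/ffunP => p; rewrite !ffunE cstarZ. Qed.
Fact cmx_normM (S T : M) : `|mulm S T : M| <= `|S| * `|T|.
Proof. by rewrite -rmorphM lecR (opnormM he). Qed.
Fact cmx_norm_star (T : M) : `|mulm (starm T) T : M| = `|T| ^+ 2.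
Proof. by rewrite -[RHS]rmorphXn -(opnorm_cstar he). Qed.

HB.instance Definition _ := isCStarAlgebra.Build R M
  cmx_mulA cmx_mulDl cmx_mulDr cmx_mulZl cmx_mulZr
  cmx_starD cmx_starZ (@starmM R D I) (@starmK R D I)
  cmx_normM cmx_norm_star.

Definition matrix_algebra : cstarType R := M.

End MatrixAlgebra.

(** * Homomorphisms *)

Lemma star_hom_comp (R : realType) (A B C : cstarType R) (f : A -> B) (g : B -> C) :
  star_hom f -> star_hom g -> star_hom (g \o f).
Proof.
by move=> [f1 f2 f3 f4] [g1 g2 g3 g4]; split=> * /=; rewrite ?(f1, f2, f3, f4) ?(g1, g2, g3, g4).
Qed.

Section StarHom.
Variables (R : realType) (A B : cstarType R) (f : A -> B) (hf : star_hom f).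

Lemma homD x y : f (x + y) = f x + f y. Proof. by case: hf. Qed.
Lemma homZ (k : R[i]) x : f (k *: x) = k *: f x. Proof. by case: hf. Qed.
Lemma homM x y : f (x ** y) = f x ** f y. Proof. by case: hf. Qed.
Lemma hom_star x : f (x^#) = (f x)^#. Proof. by case: hf. Qed.
Lemma hom0 : f 0 = 0. Proof. by have := homZ 0 0; rewrite !scale0r. Qed.
Lemma homN x : f (- x) = - f x. Proof. by rewrite -scaleN1r homZ scaleN1r. Qed.
Lemma homB x y : f (x - y) = f x - f y. Proof. by rewrite homD homN. Qed.
Lemma hom_sum (I : Type) (r : seq I) (P : pred I) (F : I -> A) :
  f (\sum_(i <- r | P i) F i) = \sum_(i <- r | P i) f (F i).
Proof. exact: (big_morph f homD hom0). Qed.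
Lemma hom_fsum (I : choiceType) (X : set I) (F : I -> A) : finite_set X ->
  f (\sum_(i \in X) F i) = \sum_(i \in X) f (F i).
Proof. by move=> fX; rewrite !fsbig_finite// hom_sum. Qed.

(* For self-adjoint [a], [f] maps [a^2 + k^2 = t e] with [t > |a^2|] to
   [f a^2 + f k^2 = t f e], whence [|f a|^2 <= t]. *)
Lemma star_hom_contractive (e : A) (e' : B) : is_unit e -> is_unit e' ->
  forall x, rnorm (f x) <= rnorm x.
Proof.
move=> he he'.
have fe1 : rnorm (f e) <= 1.
  have := rnorm_star_mul (f e); rewrite -hom_star -homM unit_star// unit_l// => h.
  have [->//|n0] := eqVneq (rnorm (f e)) 0.
  by rewrite -(mulfI n0 (etrans (mulr1 _) (etrans h (expr2 _)))).
have sa a : a^# = a -> rnorm (f a) <= rnorm a.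
  move=> as_; rewrite -ler_sqr ?nnegrE ?rnorm_ge0// -!rnorm_sq// -?hom_star ?as_//.
  apply/ler_addgt0Pr => r r0; pose t := rnorm (a ** a) + r.
  have t0 : 0 < t by rewrite ltr_wpDl// rnorm_ge0.
  have [| | |k [pk kk kc]] := @sqrt_near _ _ e he (t%:C *: e - a ** a) t.
  - by rewrite cstarB scal_star// cstarM as_.
  - by [].
  - by rewrite (_ : _ - _ = a ** a); [rewrite ltrDl|nc he].
  have ak : a ** k = k ** a.
    by apply/esym/kc; rewrite cmulBl cmulBr (scal_comm he) cmulA.
  have := rnorm_sq_le_add he' (c := f a) (d := f k).
  rewrite -!hom_star as_ (pos_star pk) -!homM ak => /(_ erefl erefl erefl).
  rewrite -homD kk (_ : a ** a + _ = t%:C *: e); last by nc he.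
  rewrite homZ rnormZ gtr0_norm// => /le_trans -> //.
  by rewrite -[leRHS]mulr1 ler_wpM2l// ltW.
move=> x; rewrite -ler_sqr ?nnegrE ?rnorm_ge0// -!rnorm_star_mul -hom_star -homM.
by apply: sa; rewrite cstarM cstarK.
Qed.

Lemma range_subalgebra : (forall x, rnorm (f x) = rnorm x) -> cstar_subalgebra (range f).
Proof.
move=> iso; split; last first.
  split.
  - by exists 0; rewrite ?hom0.
  - by move=> _ _ [x _ <-] [y _ <-]; exists (x + y); rewrite ?homD.
  - by move=> k _ [x _ <-]; exists (k *: x); rewrite ?homZ.
  - by move=> _ _ [x _ <-] [y _ <-]; exists (x ** y); rewrite ?homM.
  - by move=> _ [x _ <-]; exists (x^#); rewrite ?hom_star.
(* A point of the closure is a limit of some [f (u n)]. As [f] is isometric, [u] is Cauchy, and its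
   limit is a preimage. *)
move=> y cy.
have approx n : exists x, rnorm (y - f x) <= n.+1%:R^-1.
  have n0 : 0 < (n.+1%:R^-1 : R)%:C by rewrite ltcR invr_gt0.
  have [_ [[x _ <-]]] := cy _ (nbhsx_ballx y _ n0).
  by rewrite -ball_normE /= rnormE ltcR => /ltW; exists x.
have /choice[u hu] := approx.
have small (r : R) : 0 < r -> exists N, forall n, (N <= n)%N -> n.+1%:R^-1 <= r.
  move=> r0; have r1 : 0 <= r^-1 by rewrite invr_ge0 ltW.
  exists (Num.bound r^-1) => n Nn; rewrite -[leRHS]invrK lef_pV2 ?posrE ?invr_gt0//.
  by rewrite (le_trans (ltW (archi_boundP r1)))// ler_nat leqW.
have [l hl] : exists l, forall r, 0 < r -> exists N, forall n, (N <= n)%N ->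
    rnorm (u n - l) <= r.
  apply: cauchy_limit => r r0; have [N hN] := small (r / 2) (divr_gt0 r0 (ltr0Sn _ 1)).
  exists N => m n Nm Nn; rewrite -iso homB.
  have -> : f (u m) - f (u n) = (y - f (u n)) - (y - f (u m)).
    by rewrite opprB [RHS]addrC addrA subrK.
  rewrite (le_trans (rnormB _ _))//.
  have := le_trans (hu m) (hN _ Nm); have := le_trans (hu n) (hN _ Nn); lra.
exists l => //; apply/eqP; rewrite -subr_eq0; apply/eqP/rnorm_small => r r0.
have [N hN] := small (r / 2) (divr_gt0 r0 (ltr0Sn _ 1)).
have [M hM] := hl (r / 2) (divr_gt0 r0 (ltr0Sn _ 1)).
pose n := maxn N M.
have h1 := le_trans (hu n) (hN n (leq_maxl _ _)).
have := hM n (leq_maxr _ _); rewrite -iso homB rnormBC => h2.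
have -> : f l - y = (f l - f (u n)) - (y - f (u n)) by rewrite opprB addrA subrK.
rewrite (le_trans (rnormB _ _))//; lra.
Qed.

End StarHom.

(** * Corners of graph algebras *)

Section CornerTheory.
Variables (R : realType) (A : cstarType R) (p : A) (hp : is_projection p).
Local Notation C := (corner hp).

Definition cval (x : C) : A := sval x.

Lemma cval_inj : injective cval. Proof. exact: val_inj. Qed.
Lemma cval_hom : star_hom cval. Proof. by split. Qed.
Lemma cval_l x : p ** cval x = cval x. Proof. exact: corner_pl. Qed.
Lemma cval_r x : cval x ** p = cval x. Proof. exact: corner_pr. Qed.

Definition corner_one : C := exist _ p (corner_unit_subproof hp).

Lemma corner_one_unit : is_unit corner_one.
Proof. by move=> x; split; apply: cval_inj; [exact: cval_l|exact: cval_r]. Qed.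

Fact compress_subproof z : in_corner p (p ** z ** p).
Proof.
case: hp => pp _.
by apply/eqP; rewrite !cmulA pp -cmulA pp.
Qed.

Definition compress z : C := exist _ (p ** z ** p) (compress_subproof z).

Lemma cval_compress z : cval (compress z) = p ** z ** p. Proof. by []. Qed.
Lemma compress_cval x : compress (cval x) = x.
Proof. by apply: cval_inj; rewrite cval_compress cval_l cval_r. Qed.
Lemma compressD y z : compress (y + z) = compress y + compress z.
Proof. by apply: cval_inj; rewrite (homD cval_hom) !cval_compress cmulDr cmulDl. Qed.
Lemma compressZ (k : R[i]) z : compress (k *: z) = k *: compress z.
Proof. by apply: cval_inj; rewrite (homZ cval_hom) !cval_compress cmulZr cmulZl. Qed.
Lemma compress0 : compress 0 = 0.
Proof. by have := compressZ 0 0; rewrite !scale0r. Qed.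
Lemma compress_star z : compress (z^#) = (compress z)^#.
Proof.
apply: cval_inj; rewrite (hom_star cval_hom) !cval_compress !cstarM.
by case: hp => _ ->; rewrite cmulA.
Qed.

End CornerTheory.

Section MatrixUnits.
Variables (R : realType) (D : cstarType R) (e : D) (he : is_unit e) (I : finType).
Local Notation M := (matrix_algebra he I).
Implicit Types (i j k l : I) (a b : D).

Definition munit i j a : M :=
  ([ffun q => if q == (i, j) then a else 0] : {ffun I * I -> D}).
Definition entry (T : M) i j : D := (T : {ffun I * I -> D}) (i, j).

Lemma mx_ext (S T : M) : (forall i j, entry S i j = entry T i j) -> S = T.
Proof. by move=> h; apply/ffunP => -[i j]; exact: h. Qed.
Lemma entryD (S T : M) i j : entry (S + T) i j = entry S i j + entry T i j.
Proof. by rewrite /entry ffunE. Qed.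
Lemma entryZ (k : R[i]) (T : M) i j : entry (k *: T) i j = k *: entry T i j.
Proof. by rewrite /entry ffunE. Qed.
Lemma entryM (S T : M) i j : entry (S ** T) i j = \sum_k entry S i k ** entry T k j.
Proof. by rewrite /entry ffunE. Qed.
Lemma entry_star (T : M) i j : entry (T^#) i j = (entry T j i)^#.
Proof. by rewrite /entry ffunE. Qed.
Lemma rnorm_entry_le (T : M) i j : rnorm (entry T i j) <= rnorm T.
Proof. exact: rnorm_entry. Qed.

Lemma entry_munit i j a k l :
  entry (munit i j a) k l = if (k == i) && (l == j) then a else 0.
Proof. by rewrite /entry ffunE. Qed.

Lemma munitM i j k l a b :
  munit i j a ** munit k l b = if j == k then munit i l (a ** b) else 0.
Proof.
apply: mx_ext => r s; rewrite entryM (bigD1 j)//= big1 => [|t /negPf tj].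
  rewrite !entry_munit eqxx andbT addr0.
  case: (eqVneq j k) => [_|_] /=; last first.
    by rewrite cmul0r /entry ffunE.
  rewrite entry_munit; case: eqVneq => _ /=; rewrite ?cmul0l//.
  by case: ifP => _; rewrite ?cmul0r.
by rewrite !entry_munit tj andbF cmul0l.
Qed.
Lemma munit_star i j a : (munit i j a)^# = munit j i (a^#).
Proof.
apply: mx_ext => r s; rewrite entry_star !entry_munit andbC.
by case: ifP => _; rewrite ?cstar0.
Qed.
Lemma munitD i j a b : munit i j (a + b) = munit i j a + munit i j b.
Proof.
apply: mx_ext => r s; rewrite entryD !entry_munit.
by case: ifP => _; rewrite ?addr0.
Qed.
Lemma munitZ (k : R[i]) i j a : munit i j (k *: a) = k *: munit i j a.
Proof.
apply: mx_ext => r s; rewrite entryZ !entry_munit.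
by case: ifP => _; rewrite ?scaler0.
Qed.
Lemma munit0 i j : munit i j 0 = 0.
Proof. by apply: mx_ext => r s; rewrite entry_munit if_same /entry ffunE. Qed.
Lemma munit_sum i j (J : Type) (r : seq J) (P : pred J) (F : J -> D) :
  munit i j (\sum_(t <- r | P t) F t) = \sum_(t <- r | P t) munit i j (F t).
Proof. exact: (big_morph _ (munitD i j) (munit0 i j)). Qed.

Definition mx_one : M := \sum_i munit i i e.

Lemma entry_sum (J : Type) (r : seq J) (P : pred J) (F : J -> M) i j :
  entry (\sum_(t <- r | P t) F t) i j = \sum_(t <- r | P t) entry (F t) i j.
Proof.
apply: (big_morph (fun T => entry T i j)) => [S T|]; first exact: entryD.
by rewrite /entry ffunE.
Qed.

Lemma entry_mx_one i j : entry mx_one i j = if i == j then e else 0.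
Proof.
rewrite entry_sum (bigD1 i)//= big1 => [|k /negPf ki].
  by rewrite entry_munit eqxx addr0 eq_sym.
by rewrite entry_munit eq_sym ki.
Qed.

Lemma mx_one_unit : is_unit mx_one.
Proof.
move=> T; split; apply: mx_ext => i j; rewrite entryM.
  rewrite (bigD1 i)//= big1 => [|k /negPf ki]; rewrite entry_mx_one.
    by rewrite eqxx unit_l// addr0.
  by rewrite eq_sym ki cmul0l.
rewrite (bigD1 j)//= big1 => [|k /negPf kj]; rewrite entry_mx_one.
  by rewrite eqxx unit_r// addr0.
by rewrite kj cmul0r.
Qed.

Lemma munit_compress i (T : M) :
  munit i i e ** T ** munit i i e = munit i i (entry T i i).
Proof.
apply: mx_ext => r s; rewrite entryM (bigD1 i)//= big1 => [|t /negPf ti].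
  rewrite entryM (bigD1 i)//= big1 => [|t /negPf ti].
    rewrite !entry_munit !eqxx !andbT !addr0.
    by case: eqVneq => _ /=; case: eqVneq => _ /=;
       rewrite ?cmul0l ?cmul0r ?(unit_l he) ?(unit_r he).
  by rewrite !entry_munit ti andbF cmul0l.
by rewrite !entry_munit ti /= cmul0r.
Qed.

End MatrixUnits.

Lemma hom_family (R : realType) (E : sepgraph) (A B : cstarType R)
  (p : vertex E -> A) (t : edge E -> A) (f : A -> B) :
  star_hom f -> sepgraph_family p t -> sepgraph_family (f \o p) (f \o t).
Proof.
move=> hf [h1 h2 h3 h4 h5]; split => /=.
- by move=> u u'; rewrite -(homM hf) h1; case: eqVneq; rewrite ?(hom0 hf).
- by move=> u; rewrite -(hom_star hf) h2.
- by move=> y; rewrite -!(homM hf); have [-> ->] := h3 y.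
- move=> u X y z uX Xy Xz; rewrite -(hom_star hf) -(homM hf) (h4 u X)//.
  by case: eqVneq; rewrite ?(hom0 hf).
- move=> u X uX fX; rewrite (h5 u X)// (hom_fsum hf)//.
  by apply: eq_fsbigr => y _; rewrite (homM hf) (hom_star hf).
Qed.

Section CornerUniversal.
Variables (R : realType) (E : sepgraph) (A : graph_cstar R E) (v : vertex E).
Variables (I : finType) (vx : I -> vertex E) (ix : vertex E -> I).
Hypotheses (vxK : cancel vx ix) (ixK : cancel ix vx).
Hypothesis (srcv : forall y : edge E, src y = v).
Hypothesis (rngv : forall y : edge E, rng y <> v).
Variable ed : vertex E -> edge E.
Hypothesis (edP : forall u, u <> v -> rng (ed u) = u).

Local Notation p := (graph_vertex A).
Local Notation t := (graph_edge A).
Local Notation C := (vertex_corner A v).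
Local Notation hpv := (graph_vertex_proj A v).

Let fam : sepgraph_family p t. Proof. by case: (graph_cstarP A). Qed.
Let uniq_hom (B : cstarType R) (f g : A -> B) : star_hom f -> star_hom g ->
  (forall u, f (p u) = g (p u)) -> (forall y, f (t y) = g (t y)) -> f = g.
Proof.
move=> hf hg fp ft; case: (graph_cstarP A) => _ /(_ B _ _ (hom_family hf fam)).
move=> [h [_ hu]]; rewrite -(hu f) // -(hu g) //; split => // u /=.
  by rewrite -fp.
by rewrite -ft.
Qed.

Let pp u : p u ** p u = p u. Proof. by rewrite (relV_mul fam) eqxx. Qed.
Let ps u : (p u)^# = p u. Proof. exact: (relV_star fam). Qed.
Let pt y : p v ** t y = t y. Proof. by have [] := relE fam y; rewrite srcv. Qed.
Let tp y : t y ** p (rng y) = t y. Proof. by have [] := relE fam y. Qed.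

Lemma edge_block (y : edge E) : exists2 X, blocks (src y) X & X y.
Proof.
have [cov _ _] := blocksP (src y).
have : [set z | src z = src y] y by [].
by rewrite -cov => -[X bX Xy]; exists X.
Qed.

Let tt y : (t y)^# ** t y = p (rng y).
Proof.
by have [X bX Xy] := edge_block y; rewrite (relSCK1 fam bX Xy Xy) eqxx.
Qed.

Definition graph_one : A := \sum_i p (vx i).

Let graph_one_p u : graph_one ** p u = p u.
Proof.
rewrite cmul_suml (bigD1 (ix u))//= big1 => [|i iu].
  by rewrite ixK pp addr0.
rewrite (relV_mul fam); case: eqVneq => // iu'.
by move: iu; rewrite -iu' vxK eqxx.
Qed.
Let graph_one_star : graph_one^# = graph_one.
Proof. by rewrite cstar_sum; apply: eq_bigr => i _. Qed.
Let p_graph_one u : p u ** graph_one = p u.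
Proof. by rewrite -[LHS]cstarK cstarM graph_one_star ps graph_one_p ps. Qed.
Let graph_one_proj : is_projection graph_one.
Proof.
by split=> //; rewrite {2}/graph_one cmul_sumr; apply: eq_bigr => i _; rewrite graph_one_p.
Qed.

(* The generators lie in the corner of [graph_one], so the identity of [A] factors
   through this corner by the universal property. *)
Lemma graph_one_unit : is_unit graph_one.
Proof.
pose cp u := compress graph_one_proj (p u); pose ct y := compress graph_one_proj (t y).
have cpE u : cval (cp u) = p u by rewrite cval_compress graph_one_p p_graph_one.
have ctE y : cval (ct y) = t y.
  by rewrite cval_compress -(pt y) cmulA graph_one_p -(tp y) -!cmulA p_graph_one.
have cfam : sepgraph_family cp ct.
  case: fam => h1 h2 h3 h4 h5; have hv := cval_hom graph_one_proj.
  split.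
  - move=> u u'; apply: cval_inj; rewrite (homM hv) !cpE h1.
    by case: eqVneq; rewrite ?cpE ?(hom0 hv).
  - by move=> u; apply: cval_inj; rewrite (hom_star hv) !cpE.
  - move=> y; have [h31 h32] := h3 y.
    by split; apply: cval_inj; rewrite (homM hv) cpE ctE.
  - move=> u X y z uX Xy Xz; apply: cval_inj.
    rewrite (homM hv) (hom_star hv) !ctE (h4 u X)//.
    by case: eqVneq; rewrite ?cpE ?(hom0 hv).
  - move=> u X uX fX; apply: cval_inj; rewrite cpE (h5 u X)// (hom_fsum hv)//.
    by apply: eq_fsbigr => y _; rewrite (homM hv) (hom_star hv) ctE.
case: (graph_cstarP A) => _ /(_ _ _ _ cfam) [f [[hf fp ft] _]].
have idE : (fun x => cval (f x)) = id.
  apply: uniq_hom.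
  - exact: (star_hom_comp hf (cval_hom graph_one_proj)).
  - by split.
  - by move=> u; rewrite fp cpE.
  - by move=> y; rewrite ft ctE.
move=> x; have -> : x = cval (f x) by rewrite -[LHS]/(id x) -idE.
by split; [exact: cval_l|exact: cval_r].
Qed.

Definition path_elt (x y : edge E) : C := compress hpv (t x ** (t y)^#).

Lemma cval_path_elt x y : cval (path_elt x y) = t x ** (t y)^#.
Proof.
by rewrite cval_compress cmulA pt -cmulA -(ps v) -cstarM pt.
Qed.

Lemma path_elt_star x y : (path_elt x y)^# = path_elt y x.
Proof. by rewrite -compress_star cstarM cstarK. Qed.

Lemma path_eltM x y z : rng x = rng y ->
  path_elt x y ** path_elt y z = path_elt x z.
Proof.
move=> xy; apply: cval_inj; rewrite (homM (cval_hom hpv)) !cval_path_elt.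
by rewrite cmulA -(cmulA (t x)) tt -xy tp.
Qed.

Lemma path_eltM0 X x y y' z : blocks v X -> X y -> X y' -> y <> y' ->
  path_elt x y ** path_elt y' z = 0.
Proof.
move=> vX Xy Xy' yy'; apply: cval_inj.
rewrite (homM (cval_hom hpv)) !cval_path_elt cmulA -(cmulA (t x)).
rewrite (relSCK1 fam vX Xy Xy'); case: eqVneq => // _.
by rewrite cmul0r cmul0l.
Qed.

Lemma path_elt_sum X : blocks v X -> finite_set X ->
  \sum_(y \in X) path_elt y y = corner_one hpv.
Proof.
move=> vX fX; apply: cval_inj; rewrite (hom_fsum (cval_hom hpv))//.
rewrite [RHS](relSCK2 fam vX fX).
by apply: eq_fsbigr => y _; rewrite cval_path_elt.
Qed.

(* Left multiplication by [link i] carries the corner of [p (vx i)] into the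
   corner of [p v]. *)
Definition link i : A := if vx i == v then p v else t (ed (vx i)).

Let link_p i u : link i ** p u = if vx i == u then link i else 0.
Proof.
rewrite /link; case: eqVneq => [->|iv]; first by rewrite (relV_mul fam); case: eqVneq => [->|].
rewrite -[t _]tp edP; last exact/eqP.
by rewrite -cmulA (relV_mul fam); case: eqVneq => [->|]; rewrite ?cmul0r.
Qed.
Let p_link i : p v ** link i = link i.
Proof. by rewrite /link; case: ifP. Qed.
Let link_link i : (link i)^# ** link i = p (vx i).
Proof.
rewrite /link; case: eqVneq => [->|iv]; first by rewrite ps pp.
by rewrite tt edP//; exact/eqP.
Qed.

Section Amplify.
Variables (D : cstarType R) (e : D) (he : is_unit e).

Definition amplify (f : C -> D) (x : A) : matrix_algebra he I :=
  ([ffun q => f (compress hpv (link q.1 ** x ** (link q.2)^#))] : {ffun I * I -> D}).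

Lemma entry_amplify f x i j :
  entry (amplify f x) i j = f (compress hpv (link i ** x ** (link j)^#)).
Proof. by rewrite /entry ffunE. Qed.

(** For products, the unit [\sum_k (link k)^# ** link k] is inserted between [x] and [y]; each
    summand splits into a product of two elements of the corner, which is the matrix product. *)
Lemma amplify_hom f : star_hom f -> star_hom (amplify f).
Proof.
move=> hf; split.
- move=> x y; apply: mx_ext => i j.
  by rewrite entryD !entry_amplify cmulDr cmulDl compressD (homD hf).
- move=> k x; apply: mx_ext => i j.
  by rewrite entryZ !entry_amplify cmulZr cmulZl compressZ (homZ hf).
- move=> x y; apply: mx_ext => i j.
  rewrite entryM entry_amplify -[x in LHS](unit_r graph_one_unit).
  under eq_bigr do rewrite !entry_amplify -(homM hf).
  rewrite -(hom_sum hf); congr f; apply: cval_inj.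
  rewrite (hom_sum (cval_hom hpv)) cval_compress.
  rewrite [in LHS]/graph_one cmul_sumr !cmul_suml cmul_sumr !cmul_suml cmul_sumr cmul_suml.
  apply: eq_bigr => k _; rewrite (homM (cval_hom hpv)) !cval_compress -link_link.
  rewrite !cmulA; congr (_ ** _); congr (_ ** _); congr (_ ** _); congr (_ ** _).
  have lp : (link k)^# ** p v = (link k)^#.
    by rewrite -[p v in LHS](ps v) -cstarM p_link.
  by rewrite -[in RHS](cmulA _ (p v) (p v)) pp -[in RHS](cmulA _ _ (p v)) lp.
- move=> x; apply: mx_ext => i j.
  rewrite entry_star !entry_amplify -(hom_star hf) -compress_star.
  by rewrite !cstarM cstarK cmulA.
Qed.

(** The amplifications are defined on the whole graph algebra, so they may be compared on
    generators, where each entry is the value at 0, at the unit or at a path element. The entry at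
    [v] gives back [f] and [g]. *)
Lemma corner_hom_ext (f g : C -> D) : star_hom f -> star_hom g ->
  f (corner_one hpv) = g (corner_one hpv) ->
  (forall x y, rng x = rng y -> f (path_elt x y) = g (path_elt x y)) -> f = g.
Proof.
move=> hf hg f1 fxy.
have Efg : amplify f = amplify g.
  apply: uniq_hom; [exact: amplify_hom|exact: amplify_hom| |].
  - move=> u; apply: mx_ext => i j; rewrite !entry_amplify link_p.
    case: eqVneq => [iu|_]; last first.
      by rewrite cmul0l compress0 (hom0 hf) (hom0 hg).
    have -> : link i ** (link j)^# = if vx j == u then link i ** (link i)^# else 0.
      have ip : link i = link i ** p u by rewrite link_p iu eqxx.
      rewrite [in LHS]ip -(ps u) -cmulA -cstarM link_p.
      case: eqVneq => [ju|_]; last by rewrite cstar0 cmul0r.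
      by have -> : j = i by apply: (can_inj vxK); rewrite ju iu.
    case: ifP => _; last by rewrite compress0 (hom0 hf) (hom0 hg).
    rewrite /link; case: ifP => [_|]; last by rewrite -/(path_elt _ _) fxy.
    have -> : compress hpv (p v ** (p v)^#) = corner_one hpv; last by [].
    by apply: cval_inj; rewrite cval_compress ps !pp.
  - move=> y; apply: mx_ext => i j; rewrite !entry_amplify.
    have -> : link i ** t y = if vx i == v then t y else 0.
      rewrite -(pt y) cmulA link_p; case: ifP => iv; last by rewrite cmul0l.
      by rewrite /link iv.
    case: ifP => _; last by rewrite cmul0l compress0 (hom0 hf) (hom0 hg).
    have -> : t y ** (link j)^# = if vx j == rng y then t y ** (t (ed (rng y)))^# else 0.
      rewrite -{1}(tp y) -cmulA -{1}(ps (rng y)) -cstarM link_p.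
      case: eqVneq => [jy|_]; last by rewrite cstar0 cmul0r.
      by rewrite /link jy; case: eqVneq => // /rngv.
    case: ifP => _; last by rewrite compress0 (hom0 hf) (hom0 hg).
    by rewrite -/(path_elt _ _) fxy// edP.
apply/funext => z; have := congr1 (fun h => entry (h (cval z)) (ix v) (ix v)) Efg.
rewrite !entry_amplify /link ixK eqxx ps cval_l cval_r !compress_cval.
by [].
Qed.

(** Vertex [u] is sent to [q u] at the diagonal place of [u], and edge [y] to [a y] in row [v],
    column [rng y]. Different places make the vertex images orthogonal whatever the [q u] are, and
    the corner at [v] lands in a single entry. *)
Lemma corner_hom_exists (q : vertex E -> D) (a : edge E -> D) :
  q v = e -> (forall u, is_projection (q u)) ->
  (forall y, a y ** q (rng y) = a y) ->
  (forall u X x y, blocks u X -> X x -> X y ->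
     (a x)^# ** a y = if x == y then q (rng x) else 0) ->
  (forall u X, blocks u X -> finite_set X -> e = \sum_(y \in X) (a y ** (a y)^#)) ->
  exists f : C -> D, [/\ star_hom f, f (corner_one hpv) = e &
    forall x y, rng x = rng y -> f (path_elt x y) = a x ** (a y)^#].
Proof.
move=> qv qP aq sck1 sck2.
pose Q u := munit he (ix u) (ix u) (q u).
pose S y := munit he (ix v) (ix (rng y)) (a y).
have mfam : sepgraph_family Q S.
  split.
  - move=> u u'; rewrite munitM (can_eq ixK); case: eqVneq => // <-.
    by have [-> _] := qP u.
  - by move=> u; rewrite munit_star; have [_ ->] := qP u.
  - move=> y; rewrite srcv /Q /S !munitM !eqxx qv unit_l//.
    by rewrite aq.
  - move=> u X x y uX Xx Xy; rewrite munit_star munitM eqxx (sck1 u X)//.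
    by case: eqVneq => [->|_]; rewrite ?munit0.
  - move=> u X uX fX.
    (* Blocks are nonempty and every edge starts at [v]. *)
    have -> : u = v.
      have [cov _ ne] := blocksP u; have [y Xy] := ne _ uX.
      have : [set z | src z = u] y by rewrite -cov; exists X.
      by rewrite /= srcv.
    rewrite /Q (_ : q v = \sum_(y \in X) (a y ** (a y)^#)); last first.
      by rewrite qv; exact: sck2 uX fX.
    rewrite !fsbig_finite// munit_sum.
    by apply: eq_bigr => y _; rewrite munit_star munitM eqxx.
case: (graph_cstarP A) => _ /(_ _ _ _ mfam) [f [[hf fp ft] _]].
have fE (x : C) : f (cval x) = munit he (ix v) (ix v) (entry (f (cval x)) (ix v) (ix v)).
  by rewrite -{1}(cval_l x) -{1}(cval_r x) cmulA !(homM hf) fp /Q qv munit_compress.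
have cv := cval_hom hpv.
exists (fun x => entry (f (cval x)) (ix v) (ix v)); split.
- split.
  + by move=> x y; rewrite (homD cv) (homD hf) entryD.
  + by move=> k x; rewrite (homZ cv) (homZ hf) entryZ.
  + move=> x y; rewrite (homM cv) (homM hf) fE [in LHS](fE y) munitM eqxx.
    by rewrite !entry_munit !eqxx.
  + by move=> x; rewrite (hom_star cv) (hom_star hf) entry_star.
- by rewrite fp entry_munit !eqxx qv.
- move=> x y xy; rewrite cval_path_elt (homM hf) (hom_star hf) !ft.
  by rewrite munit_star munitM xy eqxx entry_munit !eqxx.
Qed.

End Amplify.
End CornerUniversal.

(** * The two graphs *)

Lemma fsum2 (V : nmodType) (T : choiceType) (F : T -> V) (x y : T) : x <> y ->
  \sum_(i \in [set x; y]) F i = F x + F y.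
Proof.
move=> xy; rewrite fsbigU0; first by rewrite !fsbig_set1.
- exact: finite_set1.
- exact: finite_set1.
- by move=> z [/= -> yx]; apply: xy.
Qed.

Section TwoBlocks.
Variables (R : realType) (D : cstarType R) (a r : edge4 -> D).
Hypothesis diag : forall y, (a y)^# ** a y = r y.
Hypotheses (alpha_orth : (a alpha1)^# ** a alpha2 = 0)
           (beta_orth : (a beta1)^# ** a beta2 = 0).

Lemma blocks2_orth X x y : blocks2 X -> X x -> X y ->
  (a x)^# ** a y = if x == y then r x else 0.
Proof.
have alpha_orth' : (a alpha2)^# ** a alpha1 = 0.
  by rewrite -[LHS]cstarK cstarM cstarK alpha_orth cstar0.
have beta_orth' : (a beta2)^# ** a beta1 = 0.
  by rewrite -[LHS]cstarK cstarM cstarK beta_orth cstar0.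
case: eqVneq => [<- _ _ _|xy]; first exact: diag.
by move=> [->|->] /= [?|?] [?|?]; subst x y; rewrite ?eqxx in xy *.
Qed.

Lemma blocks2_sum (e : D) X :
  e = a alpha1 ** (a alpha1)^# + a alpha2 ** (a alpha2)^# ->
  e = a beta1 ** (a beta1)^# + a beta2 ** (a beta2)^# ->
  blocks2 X -> e = \sum_(y \in X) (a y ** (a y)^#).
Proof. by move=> ea eb [->|->]; rewrite fsum2. Qed.

End TwoBlocks.

Lemma compl_projection (R : realType) (D : cstarType R) (e p : D) :
  is_unit e -> is_projection p -> is_projection (e - p).
Proof.
move=> he [pp ps]; split; last by rewrite cstarB unit_star// ps.
by rewrite cmulBl unit_l// cmulBr unit_r// pp subrr subr0.
Qed.

Section GraphE.
Variables (R : realType) (A : graph_cstar R graphE).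
Local Notation C := (vertex_corner A vE).
Local Notation one := (corner_one (graph_vertex_proj A vE)).

Definition vxE (i : 'I_4) : vertexE :=
  match val i with 0 => vE | 1 => wE1 | 2 => wE2 | _ => wE3 end.
Definition ixE (u : vertexE) : 'I_4 :=
  match u with vE => inord 0 | wE1 => inord 1 | wE2 => inord 2 | wE3 => inord 3 end.
Lemma vxEK : cancel vxE ixE.
Proof. by move=> [[|[|[|[|//]]]] hi]; apply: val_inj; rewrite /= inordK. Qed.
Lemma ixEK : cancel ixE vxE.
Proof. by case; rewrite /vxE /= inordK. Qed.
Definition edE (u : vertexE) : edge4 :=
  match u with wE2 => alpha2 | wE3 => beta2 | _ => alpha1 end.
Lemma edEP u : u <> vE -> rngE (edE u) = u. Proof. by case: u. Qed.
Lemma rngE_v (y : edge4) : rngE y <> vE. Proof. by case: y. Qed.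

Definition isoE : C := @path_elt R graphE A vE alpha1 beta1.

Lemma blocksE_blocks2 u X : blocksE u X -> blocks2 X.
Proof. by case: u. Qed.

Let srcE (y : edge4) : @src graphE y = vE. Proof. by []. Qed.
Let pe : edge4 -> edge4 -> C := @path_elt R graphE A vE.
Let peM x y z : rngE x = rngE y -> pe x y ** pe y z = pe x z.
Proof. by move=> xy; exact: (@path_eltM R graphE A vE srcE x y z xy). Qed.
Let pe_star x y : (pe x y)^# = pe y x.
Proof. exact: (@path_elt_star R graphE A vE). Qed.

Lemma isoE_partial_isometry : partial_isometry isoE.
Proof. by rewrite /partial_isometry -/(pe _ _) pe_star !peM. Qed.

(** The diagonal path elements at [alpha1] and [beta1] are [s s^#] and [s^# s]; by (SCK2), those at
    [alpha2] and [beta2] are their complements. *)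
Lemma cornerE_ext (D : cstarType R) (e : D) (f g : C -> D) : is_unit e ->
  star_hom f -> star_hom g -> f one = g one -> f isoE = g isoE -> f = g.
Proof.
move=> he hf hg f1; rewrite /isoE -/(pe _ _) => fs.
have fs' : f (pe beta1 alpha1) = g (pe beta1 alpha1).
  by rewrite -pe_star (hom_star hf) (hom_star hg) fs.
have sumE x y : blocks2 [set x; y] -> x <> y -> pe y y = one - pe x x.
  move=> bX xy; rewrite -(@path_elt_sum R graphE A vE srcE _ bX); last exact: finite_set2.
  by rewrite fsum2// addrAC subrr add0r.
have fg x : f (pe x x) = g (pe x x) -> forall y, blocks2 [set x; y] -> x <> y ->
    f (pe y y) = g (pe y y).
  by move=> fx y bX xy; rewrite (sumE x y)// (homB hf) (homB hg) f1 fx.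
have fa : f (pe alpha1 alpha1) = g (pe alpha1 alpha1).
  by rewrite -(peM (y := beta1))// (homM hf) (homM hg) fs fs'.
have fb : f (pe beta1 beta1) = g (pe beta1 beta1).
  by rewrite -(peM (y := alpha1))// (homM hf) (homM hg) fs fs'.
apply: (@corner_hom_ext R graphE A vE _
  vxE ixE vxEK ixEK srcE rngE_v edE edEP D e he f g hf hg f1).
case; case => //= _.
- exact: (fg alpha1 fa alpha2 (or_introl erefl)).
- exact: (fg beta1 fb beta2 (or_intror erefl)).
Qed.

Lemma cornerE_universal : universal_partial_isometry isoE.
Proof.
exists one; split; [exact: corner_one_unit|exact: isoE_partial_isometry|].
move=> D e w he ww.
have ws : w^# ** w ** w^# = w^# by rewrite -[RHS](congr1 cstar ww) !cstarM cstarK cmulA.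
(* [alpha1] and [beta1] share their range, so both need initial projection [w^# w]. Taking [beta1]
   to be that projection makes [alpha1 beta1^#] equal to [w]; the other two edges complete the
   blocks. *)
pose a (y : edge4) := match y with
  | alpha1 => w | alpha2 => e - w ** w^# | beta1 => w^# ** w
  | beta2 => e - w^# ** w end.
pose q (u : vertexE) := match u with
  | vE => e | wE1 => w^# ** w | wE2 => e - w ** w^# | wE3 => e - w^# ** w end.
have iP : is_projection (w^# ** w).
  by split; rewrite ?cstarM ?cstarK// cmulA ws.
have fP : is_projection (w ** w^#).
  by split; rewrite ?cstarM ?cstarK// cmulA ww.
have iP' := compl_projection he iP; have fP' := compl_projection he fP.
have diag (y : edge4) : (a y)^# ** a y = q (rngE y).
  by case: y => //=; [case: fP' => + ->|case: iP => + ->|case: iP' => + ->].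
have orth_a : (a alpha1)^# ** a alpha2 = 0.
  by rewrite /= cmulBr unit_r// cmulA ws subrr.
have orth_b : (a beta1)^# ** a beta2 = 0.
  by case: iP => /= ip ->; rewrite cmulBr unit_r// ip subrr.
have sum_a : e = a alpha1 ** (a alpha1)^# + a alpha2 ** (a alpha2)^#.
  by case: fP' => /= ip ->; rewrite ip addrC subrK.
have sum_b : e = a beta1 ** (a beta1)^# + a beta2 ** (a beta2)^#.
  by case: iP => /= ip ->; case: iP' => ip' ->; rewrite ip ip' addrC subrK.
have [|u|y|u X x y bX Xx Xy|u X bX fX|f [hf f1 fp]] :=
  @corner_hom_exists R graphE A vE 'I_4 vxE ixE ixEK srcE D e he q a.
- by [].
- case: u => //=; split; rewrite ?(unit_star he) ?(unit_l he)//.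
- case: y => /=; first by rewrite cmulA.
  + by case: fP'.
  + by case: iP.
  + by case: iP'.
- exact: (blocks2_orth diag orth_a orth_b (blocksE_blocks2 bX) Xx Xy).
- exact: (blocks2_sum sum_a sum_b (blocksE_blocks2 bX)).
have fs : f isoE = w by rewrite /isoE fp//= cstarM cstarK cmulA.
exists f; split=> // g [hg g1 gs].
by apply: (cornerE_ext he hf hg); rewrite ?f1 ?fs.
Qed.

End GraphE.

Definition unitary (R : realType) (D : cstarType R) (e u : D) : Prop :=
  u^# ** u = e /\ u ** u^# = e.

Section GraphF.
Variables (R : realType) (A : graph_cstar R graphF).
Local Notation C := (vertex_corner A vF).
Local Notation one := (corner_one (graph_vertex_proj A vF)).

Definition vxF (i : 'I_3) : vertexF :=
  match val i with 0 => vF | 1 => wF1 | _ => wF2 end.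
Definition ixF (u : vertexF) : 'I_3 :=
  match u with vF => inord 0 | wF1 => inord 1 | wF2 => inord 2 end.
Lemma vxFK : cancel vxF ixF.
Proof. by move=> [[|[|[|//]]] hi]; apply: val_inj; rewrite /= inordK. Qed.
Lemma ixFK : cancel ixF vxF.
Proof. by case; rewrite /vxF /= inordK. Qed.
Definition edF (u : vertexF) : edge4 := if u is wF2 then alpha2 else alpha1.
Lemma edFP u : u <> vF -> rngF (edF u) = u. Proof. by case: u. Qed.
Lemma rngF_v (y : edge4) : rngF y <> vF. Proof. by case: y. Qed.

Lemma blocksF_blocks2 u X : blocksF u X -> blocks2 X.
Proof. by case: u. Qed.

Let srcF (y : edge4) : @src graphF y = vF. Proof. by []. Qed.
Let pe : edge4 -> edge4 -> C := @path_elt R graphF A vF.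
Let peM x y z : rngF x = rngF y -> pe x y ** pe y z = pe x z.
Proof. by move=> xy; exact: (@path_eltM R graphF A vF srcF x y z xy). Qed.
Let pe_star x y : (pe x y)^# = pe y x.
Proof. exact: (@path_elt_star R graphF A vF). Qed.
Let peM0 X x y y' z : blocks2 X -> X y -> X y' -> y <> y' ->
  pe x y ** pe y' z = 0.
Proof. exact: (@path_eltM0 R graphF A vF srcF). Qed.
Let pe_sum x y : blocks2 [set x; y] -> x <> y -> pe x x + pe y y = one.
Proof.
move=> bX xy; rewrite -(@path_elt_sum R graphF A vF srcF _ bX); last exact: finite_set2.
by rewrite fsum2.
Qed.

Let bA : blocks2 [set alpha1; alpha2]. Proof. by left. Qed.
Let bB : blocks2 [set beta1; beta2]. Proof. by right. Qed.
Let peA12 x z : pe x alpha1 ** pe alpha2 z = 0.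
Proof. by apply: (peM0 _ _ bA) => //; [left|right]. Qed.
Let peA21 x z : pe x alpha2 ** pe alpha1 z = 0.
Proof. by apply: (peM0 _ _ bA) => //; [right|left]. Qed.
Let peB12 x z : pe x beta1 ** pe beta2 z = 0.
Proof. by apply: (peM0 _ _ bB) => //; [left|right]. Qed.
Let peB21 x z : pe x beta2 ** pe beta1 z = 0.
Proof. by apply: (peM0 _ _ bB) => //; [right|left]. Qed.

Definition uF : C := path_elt A vF alpha1 beta1 + path_elt A vF alpha2 beta2.
Definition pF : C := path_elt A vF beta1 beta1.

Lemma uF_unitary : unitary one uF.
Proof.
rewrite /unitary /uF -!/(pe _ _) cstarD !pe_star !(cmulDl, cmulDr).
rewrite !peA12 !peA21 !peB12 !peB21 !peM// !addr0 !add0r.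
by split; apply: pe_sum.
Qed.
Lemma pF_projection : is_projection pF.
Proof. by rewrite /pF -/(pe _ _); split; rewrite ?peM ?pe_star. Qed.
Lemma uF_pF : uF ** pF = path_elt A vF alpha1 beta1.
Proof. by rewrite /uF /pF -!/(pe _ _) cmulDl peM// peB21 addr0. Qed.

(** Cutting [uF] by [pF] and by its complement isolates [alpha1 beta1^#] and [alpha2 beta2^#].
    Adjoints and composition through the [beta] edges give the remaining path elements. *)
Lemma cornerF_ext (D : cstarType R) (e : D) (f g : C -> D) : is_unit e ->
  star_hom f -> star_hom g -> f one = g one -> f uF = g uF -> f pF = g pF -> f = g.
Proof.
move=> he hf hg f1 fu fp.
have fq : f (one - pF) = g (one - pF) by rewrite (homB hf) (homB hg) f1 fp.
have peE : [/\ pe beta1 beta1 = pF, pe beta2 beta2 = one - pF,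
    pe alpha1 beta1 = uF ** pF & pe alpha2 beta2 = uF ** (one - pF)].
  have b2 : pe beta2 beta2 = one - pF.
    by rewrite -(pe_sum bB)// /pF -/(pe _ _) addrAC subrr add0r.
  split=> //; first by rewrite uF_pF.
  by rewrite -b2 /uF -!/(pe _ _) cmulDl peM// peB12 add0r.
have [E1 E2 E3 E4] := peE.
have fE1 : f (pe beta1 beta1) = g (pe beta1 beta1) by rewrite E1.
have fE2 : f (pe beta2 beta2) = g (pe beta2 beta2) by rewrite E2.
have fE3 : f (pe alpha1 beta1) = g (pe alpha1 beta1).
  by rewrite E3 (homM hf) (homM hg) fu fp.
have fE4 : f (pe alpha2 beta2) = g (pe alpha2 beta2).
  by rewrite E4 (homM hf) (homM hg) fu fq.
have st x y : f (pe x y) = g (pe x y) -> f (pe y x) = g (pe y x).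
  by move=> h; rewrite -pe_star (hom_star hf) (hom_star hg) h.
have tr x y z : rngF x = rngF y -> f (pe x y) = g (pe x y) ->
    f (pe y z) = g (pe y z) -> f (pe x z) = g (pe x z).
  by move=> xy h1 h2; rewrite -(peM _ xy) (homM hf) (homM hg) h1 h2.
apply: (@corner_hom_ext R graphF A vF _
  vxF ixF vxFK ixFK srcF rngF_v edF edFP D e he f g hf hg f1).
case; case => //= _.
- exact: (tr _ beta1 _ _ fE3 (st _ _ fE3)).
- exact: (tr _ beta2 _ _ fE4 (st _ _ fE4)).
- exact: st.
- exact: st.
Qed.

Lemma cornerF_exists (D : cstarType R) (e u p : D) : is_unit e ->
  unitary e u -> is_projection p ->
  exists f : C -> D, [/\ star_hom f, f one = e, f uF = u & f pF = p].
Proof.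
move=> he [u1 u2] pP; have [pp ps] := pP.
have qP := compl_projection he pP; have [qq qs] := qP.
(* The [beta] block is the decomposition of [e] by [p], and the [alpha] block is its translate by
   [u], so [alpha1 beta1^# + alpha2 beta2^#] becomes [u p + u (e - p) = u]. *)
pose a (y : edge4) := match y with
  | alpha1 => u ** p | alpha2 => u ** (e - p) | beta1 => p | beta2 => e - p end.
pose q (w : vertexF) := match w with vF => e | wF1 => p | wF2 => e - p end.
have uu x y : (u ** x)^# ** (u ** y) = x^# ** y.
  by rewrite cstarM cmulA -(cmulA _ u^#) u1 (unit_r he).
have vv x : x ** x = x -> x^# = x -> (u ** x) ** (u ** x)^# = u ** x ** u^#.
  by move=> xx xs; rewrite cstarM cmulA -(cmulA u) xs xx.
have pq : p ** (e - p) = 0 by rewrite cmulBr (unit_r he)// pp subrr.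
have diag (y : edge4) : (a y)^# ** a y = q (rngF y).
  by case: y => /=; rewrite ?uu ?ps ?qs.
have orth_a : (a alpha1)^# ** a alpha2 = 0 by rewrite /= uu ps.
have orth_b : (a beta1)^# ** a beta2 = 0 by rewrite /= ps.
have sum_b : e = a beta1 ** (a beta1)^# + a beta2 ** (a beta2)^#.
  by rewrite /= ps qs pp qq addrC subrK.
have sum_a : e = a alpha1 ** (a alpha1)^# + a alpha2 ** (a alpha2)^#.
  by rewrite /= !vv// -cmulDl -cmulDr [p + _]addrC subrK (unit_r he).
have [|w|y|w X x y bX Xx Xy|w X bX fX|f [hf f1 fp]] :=
  @corner_hom_exists R graphF A vF 'I_3 vxF ixF ixFK srcF D e he q a.
- by [].
- by case: w => //=; split; rewrite ?(unit_star he) ?(unit_l he).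
- by case: y => //=; rewrite -cmulA ?pp ?qq.
- exact: (blocks2_orth diag orth_a orth_b (blocksF_blocks2 bX) Xx Xy).
- exact: (blocks2_sum sum_a sum_b (blocksF_blocks2 bX)).
exists f; split=> //.
  rewrite /uF (homD hf) !fp//= ps qs -!cmulA pp qq -cmulDr [p + _]addrC subrK.
  exact: (unit_r he).
by rewrite /pF fp//= ps.
Qed.

End GraphF.

(** * Representations of the shift group from a unitary and a symmetry *)

Section Unitaries.
Variables (R : realType) (D : cstarType R) (e : D) (he : is_unit e).

Lemma unitaryM u w : unitary e u -> unitary e w -> unitary e (u ** w).
Proof.
move=> [u1 u2] [w1 w2]; split; rewrite cstarM cmulA.
  by rewrite -(cmulA _ u^#) u1 (unit_r he).
by rewrite -(cmulA u) w2 (unit_r he).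
Qed.
Lemma unitary1 : unitary e e.
Proof. by rewrite /unitary unit_star// (unit_l he). Qed.
Lemma unitary_star u : unitary e u -> unitary e u^#.
Proof. by rewrite /unitary cstarK => -[]. Qed.

Lemma int_up_down (P : int -> Prop) : P 0 -> (forall n, P n -> P (1 + n)) ->
  (forall n, P n -> P (-1 + n)) -> forall n, P n.
Proof.
move=> P0 Pu Pd; elim/int_rec => // n Pn; first by rewrite -add1n PoszD; exact: Pu.
by rewrite -add1n PoszD opprD; exact: Pd.
Qed.

Section Powers.
Variables (u : D) (hu : unitary e u).

Definition upow (n : int) : D :=
  match n with Posz m => iter m (cmul u) e | Negz m => iter m.+1 (cmul u^#) e end.

Lemma upow_succ n : upow (1 + n) = u ** upow n.
Proof.
case: hu => _ u2; case: n => [m|[|m]].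
- by rewrite -PoszD add1n.
- by rewrite /= (unit_r he).
- by rewrite (_ : 1 + Negz m.+1 = Negz m) /= ?cmulA ?u2 ?(unit_l he)// !NegzE; lia.
Qed.
Lemma upow_pred n : upow (-1 + n) = u^# ** upow n.
Proof.
case: hu => u1 _; have := upow_succ (-1 + n); rewrite addrA subrr add0r => ->.
by rewrite cmulA u1 (unit_l he).
Qed.
Lemma upowD m n : upow (m + n) = upow m ** upow n.
Proof.
elim/int_up_down: m => [|m IH|m IH]; first by rewrite add0r (unit_l he).
  by rewrite -addrA !upow_succ IH cmulA.
by rewrite -addrA !upow_pred IH cmulA.
Qed.
Lemma upow_unitary n : unitary e (upow n).
Proof.
elim/int_up_down: n => [|n IH|n IH]; first exact: unitary1.
  by rewrite upow_succ; exact: unitaryM.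
by rewrite upow_pred; apply: unitaryM => //; exact: unitary_star.
Qed.
Lemma upowVl n : upow (- n) ** upow n = e.
Proof. by rewrite -upowD addNr. Qed.
Lemma upowVr n : upow n ** upow (- n) = e.
Proof. by rewrite -upowD subrr. Qed.
Lemma upow_star n : (upow n)^# = upow (- n).
Proof.
have [h _] := upow_unitary n.
by rewrite -[LHS](unit_r he) -(upowVr n) cmulA h (unit_l he).
Qed.

Variables (z : D) (zs : z^# = z) (zz : z ** z = e).

Definition conj_pow (i : int) : D := upow i ** z ** upow (- i).
Definition word_val (w : seq int) : D := foldr (fun i y => conj_pow i ** y) e w.

Lemma conj_powK i : conj_pow i ** conj_pow i = e.
Proof.
rewrite /conj_pow !cmulA -(cmulA _ (upow (- i)) (upow i)) upowVl (unit_r he)//.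
by rewrite -(cmulA _ z z) zz (unit_r he)// upowVr.
Qed.
Lemma conj_pow_unitary i : unitary e (conj_pow i).
Proof.
have h : (conj_pow i)^# = conj_pow i.
  by rewrite /conj_pow !cstarM zs !upow_star opprK cmulA.
by rewrite /unitary h conj_powK.
Qed.
Lemma word_val_letter i w : word_val (lettermul i w) = conj_pow i ** word_val w.
Proof.
case: w => //= j w; case: eqVneq => //= ->.
by rewrite cmulA conj_powK (unit_l he).
Qed.
Lemma word_valM w1 w2 : word_val (wordmul w1 w2) = word_val w1 ** word_val w2.
Proof.
elim: w1 => /= [|i w1 IH]; first by rewrite (unit_l he).
by rewrite word_val_letter IH cmulA.
Qed.
(** This is the covariance relation that makes [shift_rep] multiplicative on the semidirect
    product. *)
Lemma word_val_shift n w :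
  word_val (map (+%R n) w) = upow n ** word_val w ** upow (- n).
Proof.
elim: w => /= [|i w IH]; first by rewrite (unit_r he)// upowVr.
rewrite IH /conj_pow opprD [- n + _]addrC !upowD !cmulA.
by rewrite -(cmulA _ (upow (- n)) (upow n)) upowVl (unit_r he).
Qed.

Definition shift_rep (x : shift_group) : D := word_val (val x.1) ** upow x.2.

Lemma shift_rep_unitary : unitary_rep e shift_rep.
Proof.
split=> // [x|[x n] [y m]].
  apply: unitaryM; last exact: upow_unitary.
  elim: (val x.1) => /= [|i w IH]; first exact: unitary1.
  by apply: unitaryM => //; exact: conj_pow_unitary.
rewrite /shift_rep /= word_valM word_val_shift upowD !cmulA.
by rewrite -(cmulA _ (upow (- n)) (upow n)) upowVl (unit_r he).
Qed.
End Powers.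

Definition sg_pair (x : freeZ2 int) (n : int) : shift_group := (x, n).
Lemma sg_pairM x y n m :
  (sg_pair x n * sg_pair y m)%g = sg_pair (x * Defs.shift n y)%g (n + m).
Proof. by []. Qed.

Definition gen_u : shift_group := sg_pair 1%g 1.
Definition gen_z : shift_group := sg_pair (freeZ2_gen 0) 0.

Lemma shift_rep_u u z : shift_rep u z gen_u = u.
Proof. by rewrite /shift_rep /= (unit_l he)// (unit_r he). Qed.
Lemma shift_rep_z u z : shift_rep u z gen_z = z.
Proof.
rewrite /shift_rep /= !(unit_r he) /conj_pow oppr0 /=.
by rewrite (unit_r he) (unit_l he).
Qed.

Section Extensionality.
Variables (G : groupType) (w : G -> D) (hw : unitary_rep e w).
Lemma rep1 : w 1%g = e.
Proof.
case: hw => _ hu hM; have [h1 h2] := hu 1%g.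
by rewrite -[LHS](unit_l he) -h1 -cmulA -hM mulg1.
Qed.
Lemma repV g : w (g^-1)%g = (w g)^#.
Proof.
case: hw => _ hu hM; have [h1 h2] := hu g.
by rewrite -[RHS](unit_r he) -rep1 -(mulgV g) hM cmulA h1 (unit_l he).
Qed.
End Extensionality.

(** The two elements generate the group: conjugating [gen_z] by the [i]-th power of [gen_u] gives
    the generator of the [i]-th factor, and every reduced word is a product of such generators. *)
Lemma rep_ext w1 w2 : unitary_rep e w1 -> unitary_rep e w2 ->
  w1 gen_u = w2 gen_u -> w1 gen_z = w2 gen_z -> w1 = w2.
Proof.
move=> h1 h2 hu hz; have [_ _ m1] := h1; have [_ _ m2] := h2.
pose P g := w1 g = w2 g.
have PM g h : P g -> P h -> P (g * h)%g by rewrite /P m1 m2 => -> ->.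
have PV g : P g -> P (g^-1)%g by rewrite /P (repV h1) (repV h2) => ->.
have P1 : P 1%g by rewrite /P (rep1 h1) (rep1 h2).
have Pn n : P (sg_pair 1%g n).
  elim/int_up_down: n => [|n IH|n IH]; first exact: P1.
    have -> : sg_pair 1%g (1 + n) = (gen_u * sg_pair 1%g n)%g.
      by rewrite sg_pairM Defs.shift1 mulg1.
    exact: PM.
  have -> : sg_pair 1%g (-1 + n) = (gen_u^-1 * sg_pair 1%g n)%g.
    apply/(mulgI gen_u); rewrite mulgA mulgV mul1g sg_pairM Defs.shift1 mulg1.
    by rewrite addrA subrr add0r.
  by apply: PM => //; exact: PV.
have Pg i : P (sg_pair (freeZ2_gen i) 0).
  have -> : sg_pair (freeZ2_gen i) 0 =
      (sg_pair 1%g i * gen_z * sg_pair 1%g (- i))%g.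
    rewrite !sg_pairM Defs.shift1 mulg1 mul1g addr0 subrr; congr (sg_pair _ _).
    by apply: val_inj; rewrite /= addr0.
  by apply: (PM) => //; exact: PM.
have Px x : P (sg_pair x 0).
  case: x => w hw; elim: w hw => [|i w IH] hw.
    rewrite (_ : exist _ _ _ = (1%g : freeZ2 int)); first exact: P1.
    exact: val_inj.
  have hw' : reduced w by exact: path_sorted hw.
  have -> : sg_pair (exist _ (i :: w) hw) 0 =
      (sg_pair (freeZ2_gen i) 0 * sg_pair (exist _ w hw') 0)%g.
    rewrite sg_pairM Defs.shift0 addr0; congr (sg_pair _ _); apply: val_inj.
    by rewrite freeZ2_gen_mul /= lettermul_path.
  by apply: PM.
apply/funext => -[x n].
have -> : (x, n) = (sg_pair x 0 * sg_pair 1%g n)%g.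
  by rewrite sg_pairM Defs.shift0 mulg1 add0r.
exact: PM.
Qed.

Lemma symmetry_projection z : z^# = z -> z ** z = e ->
  is_projection ((2^-1 : R)%:C *: (e + z)).
Proof.
move=> zs zz; split; last by rewrite scaleR_star cstarD (unit_star he) zs.
rewrite cmulZl cmulZr (_ : (e + z) ** (e + z) = (e + z) + (e + z)).
  by rewrite scalerDr -half_add.
by rewrite !(cmulDl, cmulDr) zz !(unit_l he) (unit_r he); nc he.
Qed.

Lemma projection_symmetry p : is_projection p ->
  (p + p - e)^# = p + p - e /\ (p + p - e) ** (p + p - e) = e.
Proof.
move=> [pp ps]; split; first by rewrite cstarB cstarD (unit_star he) ps.
rewrite !(cmulDl, cmulDr, cmulNl, cmulNr) pp !(unit_l he) (unit_r he); nc he.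
Qed.

End Unitaries.

(** * The corner of the second graph as a group algebra *)

Section GroupAlgebra.
Variables (R : realType) (B : graph_cstar R graphF) (K : group_cstar R shift_group).
Local Notation C := (vertex_corner B vF).
Local Notation one := (corner_one (graph_vertex_proj B vF)).
Local Notation k := (@group_cstar_rep R shift_group K).
Local Notation half x := ((2^-1 : R)%:C *: x).

Lemma cornerF_group_cstar : star_isomorphic C K.
Proof.
have [eK [kr kU]] := group_cstarP K; have [heK ku kM] := kr.
have he1 := @corner_one_unit _ _ _ (graph_vertex_proj B vF).
pose U := k gen_u; pose Z := k gen_z.
have gzz : (gen_z * gen_z)%g = 1%g.
  rewrite sg_pairM Defs.shift0 addr0 (_ : (_ * _)%g = 1%g)//; exact: val_inj.
have ZZ : Z ** Z = eK by rewrite /Z -kM gzz (rep1 heK kr).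
have Zs : Z^# = Z.
  have [Z1 _] := ku gen_z.
  by rewrite -[LHS](unit_r heK) -ZZ cmulA Z1 (unit_l heK).
have [f [hf f1 fu fp]] :=
  cornerF_exists B heK (ku gen_u) (symmetry_projection heK Zs ZZ).
have [zs zz] := projection_symmetry he1 (pF_projection B).
set z := pF B + pF B - one in zs zz.
have uu := uF_unitary B.
have wr := shift_rep_unitary he1 uu zs zz.
have [g [[hg g1 gk] _]] := kU C one _ wr.
have gU : g U = uF B by rewrite gk shift_rep_u.
have gZ : g Z = z by rewrite gk shift_rep_z.
have cst : star_hom (g \o f) by exact: star_hom_comp.
have gf : g \o f = id.
  apply: (cornerF_ext he1 cst); first by split.
  - by rewrite /= f1 g1.
  - by rewrite /= fu gU.
  - rewrite /= fp (homZ hg) (homD hg) g1 gZ /z.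
    rewrite (_ : one + (pF B + pF B - one) = pF B + pF B); last first.
      by rewrite addrC subrK.
    by rewrite scalerDr -half_add.
(* Uniqueness in the universal property of [K] applies once [f] is known to carry the representation
   in the corner back to [k], which [rep_ext] reduces to [gen_u] and [gen_z]. *)
have fg : f \o g = id.
  have [h [_ hu]] := kU K eK k kr.
  have fgr : star_hom (f \o g) by exact: star_hom_comp.
  have fwr : unitary_rep eK (fun x => f (shift_rep one (uF B) z x)).
    have [_ wu wM] := wr; split=> // [x|x y]; last by rewrite wM (homM hf).
    by have [h1 h2] := wu x; rewrite -!(hom_star hf) -!(homM hf) h1 h2.
  have fwk : (fun x => f (shift_rep one (uF B) z x)) = k.
    apply: (rep_ext heK fwr kr); first by rewrite shift_rep_u.
    rewrite shift_rep_z// /z (homB hf) (homD hf) f1 fp -half_add.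
    by rewrite addrC addrA addNr add0r.
  rewrite -(hu (f \o g)); last first.
    split=> // [|x] /=; first by rewrite g1.
    by rewrite gk -[RHS](congr1 (fun w => w x) fwk).
  by apply/esym; rewrite -(hu id).
exists f => //; exists g => x; first by have := congr1 (fun h => h x) gf.
by have := congr1 (fun h => h x) fg.
Qed.

End GroupAlgebra.

(** * Embedding by unitary dilation *)

Section Embedding.
Variables (R : realType) (A : graph_cstar R graphE) (B : graph_cstar R graphF).
Local Notation P := (vertex_corner A vE).
Local Notation Q := (vertex_corner B vF).
Local Notation oneP := (corner_one (graph_vertex_proj A vE)).
Local Notation oneQ := (corner_one (graph_vertex_proj B vF)).
Local Notation s := (isoE A).

Let heP : is_unit oneP. Proof. exact: corner_one_unit. Qed.
Let heQ : is_unit oneQ. Proof. exact: corner_one_unit. Qed.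
Local Notation M2 := (matrix_algebra heP 'I_2).
Local Notation mu := (munit heP).
Let i0 : 'I_2 := ord0.
Let i1 : 'I_2 := ord_max.

Let ss : s ** s^# ** s = s. Proof. exact: isoE_partial_isometry. Qed.
Let sss : s^# ** s ** s^# = s^#.
Proof. by rewrite -[RHS](congr1 cstar ss) !cstarM cstarK cmulA. Qed.

(** The defect operators of a partial isometry are projections, so no square roots occur. The mixed
    terms in the products vanish one by one, which is why [s^#] can stand without the usual minus
    sign. *)
Definition halmos : M2 :=
  mu i0 i0 s + mu i0 i1 (oneP - s ** s^#) +
  (mu i1 i0 (oneP - s^# ** s) + mu i1 i1 (s^#)).

Lemma halmos_unitary : unitary (mx_one heP 'I_2) halmos.
Proof.
have pP : is_projection (s^# ** s) by split; rewrite ?cstarM ?cstarK// cmulA sss.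
have qP : is_projection (s ** s^#) by split; rewrite ?cstarM ?cstarK// cmulA ss.
have [pp ps] := compl_projection heP pP; have [qq qs] := compl_projection heP qP.
have sp : s ** (oneP - s^# ** s) = 0.
  by rewrite cmulBr (unit_r heP) cmulA ss subrr.
have qs0 : (oneP - s ** s^#) ** s = 0.
  by rewrite cmulBl (unit_l heP) ss subrr.
have ps0 : (oneP - s^# ** s) ** s^# = 0.
  by rewrite cmulBl (unit_l heP) sss subrr.
have sq : s^# ** (oneP - s ** s^#) = 0.
  by rewrite cmulBr (unit_r heP) cmulA sss subrr.
have H (i j : 'I_2) : entry halmos i j = match val i, val j with
    | 0%N, 0%N => s | 0%N, _ => oneP - s ** s^#
    | _, 0%N => oneP - s^# ** s | _, _ => s^# end.
  by case: i j => [[|[|//]] hi] [[|[|//]] hj];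
    rewrite !entryD !entry_munit /= ?addr0 ?add0r.
have N (i j : 'I_2) : entry (mx_one heP 'I_2) i j =
    if val i == val j then oneP else 0 by rewrite entry_mx_one.
split; apply: mx_ext => i j; rewrite entryM big_ord_recl big_ord1 N !entry_star !H;
  case: i j => [[|[|//]] hi] [[|[|//]] hj] /=;
  rewrite ?ps ?qs ?cstarK ?pp ?qq ?sp ?qs0 ?ps0 ?sq ?addr0 //.
- by rewrite addrC subrK.
- by rewrite subrK.
- by rewrite addrC subrK.
- by rewrite subrK.
Qed.

Lemma star_embeds_corners : star_embeds P Q.
Proof.
have [e [heE _ univ]] := cornerE_universal A.
have ee : e = oneP by have [h _] := heE oneP; rewrite -[LHS](unit_r heP) h.
rewrite ee {e ee heE} in univ.
pose t := uF B ** pF B.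
have tp : partial_isometry t.
  have [u1 _] := uF_unitary B; have [pp ps] := pF_projection B.
  rewrite /partial_isometry /t cstarM ps !cmulA -(cmulA _ (uF B)^#) u1.
  by rewrite (unit_r heQ) -!cmulA !pp.
have [phi [[hphi phi1 phis] _]] := univ Q oneQ t heQ tp.
have heM := @mx_one_unit _ _ _ heP 'I_2.
(* Since [s s^# s = s] and [(oneP - s^# s) s^# s = 0], the product [halmos ** p] has [s] in the
   upper left entry and 0 elsewhere. *)
pose p : M2 := mu i0 i0 (s^# ** s).
have pP : is_projection p.
  split; first by rewrite munitM eqxx cmulA sss.
  by rewrite munit_star cstarM cstarK.
have [psi [hpsi psi1 psiu psip]] := cornerF_exists B heM halmos_unitary pP.
(* [psi \o phi] is unital but maps [s] to [diag (s, 0)], so the lower right entry calls for a unital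
   homomorphism that kills [s]; it exists because 0 is a partial isometry. *)
have zero_pi : partial_isometry (0 : P) by rewrite /partial_isometry cmul0r.
have [chi [[hchi chi1 chis] _]] := univ P oneP 0 heP zero_pi.
pose delta x : M2 := mu i0 i0 x + mu i1 i1 (chi x).
have hdelta : star_hom delta.
  split=> [x y|c x|x y|x].
  - by rewrite /delta (homD hchi) !munitD addrACA.
  - by rewrite /delta (homZ hchi) !munitZ scalerDr.
  - rewrite /delta (homM hchi) !(cmulDl, cmulDr) !munitM /= addr0 add0r.
    by [].
  - by rewrite /delta (hom_star hchi) cstarD !munit_star.
have hpp : star_hom (psi \o phi) by exact: star_hom_comp.
have E : psi \o phi = delta.
  apply: (cornerE_ext heM hpp hdelta) => /=.
    rewrite phi1 psi1 /mx_one big_ord_recl big_ord1 /delta chi1.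
    by congr (_ + munit _ _ _ _); apply: val_inj.
  rewrite phis (homM hpsi) psiu psip /delta chis munit0 addr0.
  rewrite /halmos /p !cmulDl !munitM /=.
  by rewrite cmulA ss cmulBl (unit_l heP) cmulA sss subrr munit0 !addr0.
(* [|x| <= |delta x| = |psi (phi x)| <= |phi x| <= |x|], the first bound being that of the upper
   left entry. *)
have iso x : rnorm (phi x) = rnorm x.
  apply/eqP; rewrite eq_le (star_hom_contractive hphi heP heQ) /=.
  apply: le_trans (star_hom_contractive hpsi heQ heM (phi x)).
  rewrite -[psi (phi x)]/((psi \o phi) x) E.
  have := rnorm_entry_le (delta x) i0 i0.
  by rewrite /delta entryD !entry_munit !eqxx /= addr0.
exists phi; split=> //; last exact: range_subalgebra.
move=> x y xy; apply/eqP; rewrite -subr_eq0; apply/eqP/rnorm_eq0.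
by rewrite -iso (homB hphi) xy subrr rnorm0.
Qed.

End Embedding.

Theorem lemma5p5 (R : realType) :
  (forall A : graph_cstar R graphE,
     exists s : vertex_corner A vE, universal_partial_isometry s) /\
  (forall (B : graph_cstar R graphF) (K : group_cstar R shift_group),
     star_isomorphic (vertex_corner B vF) K) /\
  (forall (A : graph_cstar R graphE) (B : graph_cstar R graphF),
     star_embeds (vertex_corner A vE) (vertex_corner B vF)).
Proof.
split; first by move=> A; exists (isoE A); exact: cornerE_universal.
split; first exact: cornerF_group_cstar.
exact: star_embeds_corners.
Qed.
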